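(* For every $p,q>2$ the ground state energy level $\mathcal{E}_{p,q}:[0,+\infty)\to\mathbb{R}\cup\{-\infty\}$ is non-positive and non-increasing on $[0,+\infty)$. Moreover: (i) if $q<\max\left\{4,\frac p2+1\right\}$, then $\mathcal{E}_{p,q}(\mu)>-\infty$ for every $\mu>0$; (ii) if $p\in(2,6)$ and $q=4$, then $\mathcal{E}_{p,4}(\mu)=0$ if $\mu\in(0,2]$, and $\mathcal{E}_{p,4}(\mu)=-\infty$ if $\mu>2$; (iii) if $q>\max\left\{4,\frac p2+1\right\}$, then $\mathcal{E}_{p,q}(\mu)=-\infty$ for every $\mu>0$. Finally, if $q\neq\frac p2+1$ or $p<6$, then $\mathcal{E}_{p,q}$ is continuous on every interval where it is finite.
   Context: For $p,q>2$ the energy functional $E_{p,q}:H^1(\mathbb{R})\to\mathbb{R}$ is $E_{p,q}(v):=\frac12\|v'\|_{L^2(\mathbb{R})}^2+\frac1p\|v\|_{L^p(\mathbb{R})}^p-\frac1q|v(0)|^q$. For $\mu\geq0$, $H^1_\mu(\mathbb{R}):=\{v\in H^1(\mathbb{R}):\|v\|_{L^2(\mathbb{R})}^2=\mu\}$, and the ground state energy level is $\mathcal{E}_{p,q}(\mu):=\inf_{u\in H^1_\mu(\mathbb{R})}E_{p,q}(u)$ (so $\mathcal{E}_{p,q}(0)=0$). Functions are real-valued. *)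

(* Defs.v *)
From mathcomp Require Import all_boot all_order all_algebra.
From mathcomp Require Import all_classical all_reals all_analysis.
Import Order.TTheory GRing.Theory Num.Theory.
Import numFieldNormedType.Exports.

Set Implicit Arguments.
Unset Strict Implicit.
Unset Printing Implicit Defensive.

Local Open Scope classical_set_scope.
Local Open Scope ring_scope.

Section Sobolev.
Context {R : realType}.
Implicit Types (u v g phi : R -> R) (p q mu : R).

Local Notation leb := (@lebesgue_measure R).

Definition L2 : set (R -> R) := [set f | f \in Lfun leb 2%:E].

(* ||f||_{L^r(R)}^r, possibly +oo *)
Definition Lnorm_pow (r : R) (f : R -> R) : \bar R :=
  ('N[leb]_(r%:E)[EFin \o f] `^ r)%E.

Definition C1c : set (R -> R) := [set phi : R -> R |
  [/\ forall x, derivable phi x 1,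
      continuous (phi^`())%classic &
      compact (closure [set x | phi x != 0])]].

(* Weak derivatives are taken against C^1_c test functions, as in Brezis,
   Functional Analysis, Sobolev Spaces and PDEs, Section 8.2.  For u and g in
   L^2(R) both integrands are Lebesgue integrable. *)
Definition is_weak_derivative u g : Prop := forall phi, C1c phi ->
  \int[leb]_x (u x * (phi^`())%classic x) = - \int[leb]_x (g x * phi x).

(* H^1(R).  Every class of functions in H^1(R) has exactly one continuous
   representative, and v(0) refers to it; the elements are therefore taken to
   be these representatives. *)
Definition H1 : set (R -> R) := [set v : R -> R |
  [/\ continuous v, L2 v & exists2 g, L2 g & is_weak_derivative v g]].

(* The weak derivative of v in H^1(R); it is determined up to a null set. *)
Definition weak_derivative v : R -> R :=
  xget (cst 0) [set g | L2 g /\ is_weak_derivative v g].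

Definition H1_mass mu : set (R -> R) :=
  H1 `&` [set v | Lnorm_pow 2 v = mu%:E].

Definition energy p q v : \bar R :=
  ((2^-1)%:E * Lnorm_pow 2 (weak_derivative v)
   + (p^-1)%:E * Lnorm_pow p v
   - (q^-1 * `|v 0| `^ q)%:E)%E.

Definition ground_level p q mu : \bar R :=
  ereal_inf (energy p q @` H1_mass mu).

End Sobolev.

(* Main.v *)
(** Testing the weak derivative against C^1 approximations of the indicator of
    ]a, b] gives v b - v a = \int_a^b v', hence uniqueness of v' and a local
    Lipschitz control that replaces all chain rules.  Two trace inequalities
    follow: |v 0|^4 <= ||v||^2 ||v'||^2, with equality for exp (- lam |x|), and
    c |v 0|^(p/2+1) <= ||v'||^2 / 2 + ||v||_p^p / p.  They make the energy
    coercive when q < max (4, p/2+1), and the first one gives a nonnegative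
    energy when q = 4 and the mass is at most 2.

    Monotonicity: for v of mass mu <= nu and w a spread-out exponential of mass
    1, some s >= 0 bounded in terms of nu gives v + s w the mass nu exactly;
    spreading w further makes its contribution to the energy vanish.  The values
    -oo then come from concentrated exponentials whose mass is at most mu.

    Continuity: c v with c <= 1 has mass c^2 mu and an energy larger than that
    of v by at most (1 - c^q) |v 0|^q / q, and coercivity bounds |v 0| along
    near-minimizers. *)
Require Import Defs.
From mathcomp Require Import all_boot all_order all_algebra.
From mathcomp Require Import all_classical all_reals all_analysis.
From mathcomp Require Import measurable_realfun ring lra.
Import Order.TTheory GRing.Theory Num.Theory.
Import numFieldNormedType.Exports.

Set Implicit Arguments.
Unset Strict Implicit.
Unset Printing Implicit Defensive.

Local Open Scope classical_set_scope.
Local Open Scope ring_scope.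

(** * A C^1 step function and approximate identities *)

Section RealCalculus.
Context {R : realType}.
Implicit Types (f d : R -> R) (a b x y N : R).
Local Notation leb := (@lebesgue_measure R).

(** Height A and rate lam give an exponential of mass A^2/lam, with ||v'||^2 = lam A^2 and an L^p
    term of order A^p/lam, to be compared with A^q. The thresholds 4, p/2+1 and the mass 2 come from
    balancing these orders. With height d and rate d^2 the mass is 1 for every d, while the slope,
    the L^p norm and the value at 0 vanish with d: mass is added at no cost in the limit, whereas
    multiplying v by a factor above 1 would raise both positive terms. The mass 2 demands the sharp
    constant in the first trace inequality, which is why v(0)^2 is estimated from both half-lines.
    Coercivity absorbs the trace term in only half of the positive terms; the other half bounds
    ||v'|| along near-minimizers, uniformly for bounded masses. This is needed for continuity in the
    subcritical range only: elsewhere, under the hypothesis of the last claim, the level is constant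
    where finite. Scaling fails at mass 0, where c does not tend to 1; there the trace is small
    because the mass is. *)

Lemma is_derive_quadratic_remainder f (C : R) x dx :
  (forall y, `|f y - f x - dx * (y - x)| <= C * (y - x) ^+ 2) ->
  is_derive x 1 f dx.
Proof.
move=> H.
suff L : h^-1 *: (f (h *: 1 + x) - f x) @[h --> 0^'] --> dx.
  by apply: DeriveDef; [apply/cvg_ex; exists dx|exact: cvg_lim L].
apply/cvgrPdist_le => e e0; near=> h.
have h0 : h != 0 by near: h; exact: nbhs_dnbhs_neq.
have hn0 : 0 < `|h| by rewrite normr_gt0.
have := H (h *: 1 + x).
rewrite [h *: 1](mulr1 h) addrK => H1.
rewrite -(ler_pM2r hn0) -normrM /GRing.scale/= mulrBl.
rewrite (mulrAC h^-1) mulVf// mul1r distrC.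
apply: (le_trans H1).
rewrite -(real_normK (num_real h)) expr2 mulrA ler_pM2r//.
have C1 : 0 < `|C| + 1 by rewrite ltr_wpDl.
apply: (@le_trans _ _ ((`|C| + 1) * `|h|)).
  by rewrite ler_wpM2r// (le_trans (ler_norm C))// lerDl.
rewrite mulrC -ler_pdivlMr//.
near: h; apply: dnbhs0_le.
by rewrite divr_gt0// ltr_wpDl.
Unshelve. all: by end_near. Qed.

(* Square of the positive part: the simplest C^1 function that vanishes on a
   half-line; [step] is a second difference of it, with derivative [tent]. *)
Definition sqpos x := Num.max x 0 ^+ 2.

(** The bound holds across the kink of the derivative too, so piecewise quadratics can be
    differentiated at their breakpoints without one-sided limits. *)
Lemma sqpos_remainder x y :
  `|sqpos y - sqpos x - 2 * Num.max x 0 * (y - x)| <= (y - x) ^+ 2.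
Proof.
rewrite /sqpos ler_norml; have := sqr_ge0 (y - x).
by have [] := leP x 0; have [] := leP y 0 => *; apply/andP; split; nra.
Qed.

Definition step x := 2 * (sqpos x - 2 * sqpos (x - 2^-1) + sqpos (x - 1)).

(** Hat of base [[0, 1]] and height 2, hence of integral 1. *)
Definition tent x :=
  4 * (Num.max x 0 - 2 * Num.max (x - 2^-1) 0 + Num.max (x - 1) 0).

(** The constant is 2 (1 + 2 + 1), from the weights of the second difference. *)
Lemma step_remainder x y :
  `|step y - step x - tent x * (y - x)| <= 8 * (y - x) ^+ 2.
Proof.
have := sqpos_remainder x y.
have := sqpos_remainder (x - 2^-1) (y - 2^-1).
have := sqpos_remainder (x - 1) (y - 1).
rewrite !opprB !addrA !subrK /step /tent !ler_norml.
move: (sqpos _) (sqpos _) (sqpos _) (sqpos _) (sqpos _) (sqpos _).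
move: (Num.max _ _) (Num.max _ _) (Num.max _ _) => m1 m2 m3 s1 s2 s3 s4 s5 s6.
by move=> /andP[? ?] /andP[? ?] /andP[? ?]; apply/andP; split; nra.
Qed.

Lemma step_le0 x : x <= 0 -> step x = 0.
Proof.
move=> x0; rewrite /step /sqpos !max_r//; last 2 first.
- lra.
- lra.
by rewrite expr0n/=; ring.
Qed.

Lemma step_ge1 x : 1 <= x -> step x = 1.
Proof.
move=> x1; rewrite /step /sqpos !max_l//; last 3 first.
- lra.
- lra.
- lra.
by field.
Qed.

Lemma step_itv x : 0 <= step x <= 1.
Proof.
rewrite /step /sqpos.
by have [] := leP x 0; have [] := leP (x - 2^-1) 0; have [] := leP (x - 1) 0 => *;
  apply/andP; split; nra.
Qed.

Lemma tent_ge0 x : 0 <= tent x.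
Proof.
rewrite /tent.
by have [] := leP x 0; have [] := leP (x - 2^-1) 0; have [] := leP (x - 1) 0 => *;
  nra.
Qed.

Lemma tent_le0 x : x <= 0 -> tent x = 0.
Proof.
move=> x0; rewrite /tent !max_r//; last 2 first.
- lra.
- lra.
by ring.
Qed.

Lemma tent_ge1 x : 1 <= x -> tent x = 0.
Proof.
move=> x1; rewrite /tent !max_l//; last 3 first.
- lra.
- lra.
- lra.
by field.
Qed.

Lemma continuous_tent : continuous tent.
Proof.
move=> x; apply: cvgM; first exact: cvg_cst.
have M c : Num.max (y - c) 0 @[y --> x] --> Num.max (x - c) 0.
  apply: (@continuous_max _ _ (fun y => y - c) (cst 0)).
  - by apply: cvgB; [exact: cvg_id|exact: cvg_cst].
  - exact: cvg_cst.
apply: cvgD; last exact: M.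
apply: cvgB; last by apply: cvgM; [exact: cvg_cst|exact: M].
by have := M 0; under eq_cvg do rewrite subr0; rewrite subr0.
Qed.

(** One-sided mollifier: for N > 0 it has integral 1 and lives on [a, a + 1/N]. *)
Definition delta_approx N a x := N * tent (N * (x - a)).

Lemma continuous_delta_approx N a : continuous (delta_approx N a).
Proof.
move=> x; apply: cvgM; first exact: cvg_cst.
apply: (@continuous_comp _ _ _ (fun y => N * (y - a)) tent).
  apply: cvgM; first exact: cvg_cst.
  by apply: cvgB; [exact: cvg_id|exact: cvg_cst].
exact: continuous_tent.
Qed.

Lemma is_derive_step N a x :
  is_derive x 1 (fun y => step (N * (y - a))) (delta_approx N a x).
Proof.
apply: (@is_derive_quadratic_remainder _ (8 * N ^+ 2)) => y.
have := step_remainder (N * (x - a)) (N * (y - a)).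
rewrite (_ : N * (y - a) - _ = N * (y - x)); last by ring.
rewrite /delta_approx exprMn.
by rewrite (_ : N * _ * (y - x) = tent (N * (x - a)) * (N * (y - x))) ?(mulrA 8)//; ring.
Qed.

Lemma delta_approx_supp N a x : 0 < N -> ~ (`[a, a + N^-1]%classic x) ->
  delta_approx N a x = 0.
Proof.
move=> N0; rewrite /= in_itv/= => /negP; rewrite negb_and -!ltNge /delta_approx.
move=> /orP[xa|xa]; [rewrite tent_le0 ?mulr0//|rewrite tent_ge1 ?mulr0//].
  by rewrite pmulr_rle0// subr_le0 ltW.
by rewrite mulrC -ler_pdivrMr// div1r; lra.
Qed.

Lemma delta_approx_ge0 N a x : 0 < N -> 0 <= delta_approx N a x.
Proof. by move=> N0; rewrite mulr_ge0 ?tent_ge0// ltW. Qed.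

Lemma Rintegral_supp (D : set R) f : (forall x, ~ D x -> f x = 0) ->
  \int[leb]_x f x = \int[leb]_(x in D) f x.
Proof.
move=> H; rewrite [RHS]Rintegral_mkcond; apply: eq_Rintegral => x _.
by rewrite patchE; case: ifPn => // /negP; rewrite inE => /H.
Qed.

Lemma continuous_integrable_itv f a b : continuous f ->
  leb.-integrable `[a, b] (EFin \o f).
Proof.
move=> cf; apply: continuous_compact_integrable; first exact: segment_compact.
exact: continuous_subspaceT.
Qed.

Lemma Rintegral_delta_approx N a : 0 < N ->
  \int[leb]_(x in `[a, a + N^-1]) delta_approx N a x = 1.
Proof.
move=> N0; have aN : a < a + N^-1 by rewrite ltrDl invr_gt0.
have D (x : R) := is_derive_step N a x.
have C : continuous (fun y => step (N * (y - a))).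
  by move=> x; apply: differentiable_continuous; apply/derivable1_diffP;
    exact: ex_derive.
rewrite /Rintegral (@continuous_FTC2 _ _ (fun y => step (N * (y - a))))//.
- rewrite /= subrr mulr0 (step_le0 (lexx 0)) (addrC a) addrK divff ?gt_eqF//.
  by rewrite step_ge1// subr0.
- exact/continuous_subspaceT/continuous_delta_approx.
- split.
  + by move=> x _; exact: ex_derive.
  + exact/cvg_at_right_filter/C.
  + exact/cvg_at_left_filter/C.
- by move=> x _; rewrite derive1E derive_val.
Qed.

(** A weighted mean of values of [f] lying between [f a - e] and [f a + e] stays between them. *)
Lemma Rintegral_mul_delta_approx f N a (e : R) : continuous f -> 0 < N ->
  (forall x, a <= x <= a + N^-1 -> `|f x - f a| <= e) ->
  `|\int[leb]_x (f x * delta_approx N a x) - f a| <= e.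
Proof.
move=> cf N0 fe.
rewrite (@Rintegral_supp `[a, a + N^-1]); last first.
  by move=> x /(delta_approx_supp N0) ->; rewrite mulr0.
have cM (g : R -> R) : continuous g -> continuous (fun x => g x * delta_approx N a x).
  by move=> cg x; apply: cvgM; [exact: cg|exact: continuous_delta_approx].
have I (c : R) : \int[leb]_(x in `[a, a + N^-1]) (c * delta_approx N a x) = c.
  rewrite RintegralZl// ?Rintegral_delta_approx ?mulr1//.
  exact/continuous_integrable_itv/continuous_delta_approx.
have B (g1 g2 : R -> R) : continuous g1 -> continuous g2 ->
    (forall x, a <= x <= a + N^-1 -> g1 x <= g2 x) ->
    \int[leb]_(x in `[a, a + N^-1]) (g1 x * delta_approx N a x)
    <= \int[leb]_(x in `[a, a + N^-1]) (g2 x * delta_approx N a x).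
  move=> c1 c2 g12; apply: le_Rintegral => //.
  - exact/continuous_integrable_itv/cM.
  - exact/continuous_integrable_itv/cM.
  - move=> x; rewrite /= in_itv/= => /g12 g12x.
    by rewrite ler_wpM2r// delta_approx_ge0.
rewrite ler_norml; apply/andP; split.
  rewrite lerBrDl -{1}(I (f a - e)); apply: (B (cst (f a - e))) => //.
    by move=> x; exact: cvg_cst.
  by move=> x /fe; rewrite ler_norml => /andP[? ?] /=; lra.
rewrite lerBlDl -{1}(I (f a + e)); apply: (B _ (cst (f a + e))) => //.
  by move=> x; exact: cvg_cst.
by move=> x /fe; rewrite ler_norml => /andP[? ?] /=; lra.
Qed.

Lemma cvg_Rintegral_mul_delta_approx f a : continuous f ->
  \int[leb]_x (f x * delta_approx n.+1%:R a x) @[n --> \oo] --> f a.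
Proof.
move=> cf; apply/cvgrPdist_le => e e0.
have /cvgrPdist_le/(_ _ e0) := cf a.
move=> [d /= d0 dP].
near=> n; rewrite distrC; apply: Rintegral_mul_delta_approx => // x /andP[ax xa].
rewrite distrC; apply: dP; rewrite /= ltr_norml.
have : n.+1%:R^-1 < d.
  by near: n; exact: (near_infty_natSinv_lt (PosNum d0)).
by move: n.+1%:R^-1 xa => z xz zd; apply/andP; split; lra.
Unshelve. all: by end_near. Qed.

End RealCalculus.

(** * Functions in L^2 and their weak derivatives *)

Section Integrable.
Context d (T : measurableType d) (R : realType) (mu : {measure set T -> \bar R}).
Implicit Types (D : set T) (f g : T -> R).

Lemma integrable_scale D c f : measurable D ->
  mu.-integrable D (EFin \o f) ->
  mu.-integrable D (EFin \o (fun x => c * f x)).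
Proof. by move=> mD If; apply: (integrableZl mD c If). Qed.

Lemma integrable_add D f g : measurable D ->
  mu.-integrable D (EFin \o f) -> mu.-integrable D (EFin \o g) ->
  mu.-integrable D (EFin \o (fun x => f x + g x)).
Proof. by move=> mD If Ig; apply: (integrableD mD If Ig). Qed.

Lemma integrable_le D f g : measurable D -> measurable_fun setT f ->
  (forall x, D x -> `|f x| <= g x) -> mu.-integrable D (EFin \o g) ->
  mu.-integrable D (EFin \o f).
Proof.
move=> mD mf fg Ig.
apply: (@le_integrable _ _ _ _ D mD (EFin \o f) (EFin \o g)) => //.
  by apply/measurable_EFinP; exact: measurable_funTS.
by move=> x Dx /=; rewrite lee_fin (le_trans (fg _ Dx))// ler_norm.
Qed.

End Integrable.

Section WeakDerivative.
Context {R : realType}.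
Implicit Types (f g u v w phi : R -> R) (a b x y lam : R).
Local Notation leb := (@lebesgue_measure R).

Lemma L2P f : L2 f <-> measurable_fun setT f /\
  leb.-integrable setT (EFin \o (fun x => f x ^+ 2)).
Proof.
split=> [Hf|[mf intf]].
  have Hf' : f \in Lfun leb 2%:E by [].
  split; last exact: Lfun2_integrable_sqr.
  by have := sub_Lfun_mfun Hf'; rewrite inE.
suff : f \in Lfun leb 2%:E by [].
rewrite inE; apply/andP; split; rewrite inE//=.
rewrite /finite_norm unlock poweR_lty//=.
have /integrableP[_] := intf.
by under eq_integral do rewrite /= normrX -powR_mulrn//.
Qed.

Lemma Lnorm_powE r f : 0 < r ->
  Lnorm_pow r f = (\int[leb]_x (`|f x| `^ r)%:E)%E.
Proof.
move=> r0; rewrite /Lnorm_pow poweR_Lnorm ?gt_eqF//.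
Qed.

(** Real-valued, hence meaningful on [L2] only: an infinite integral would be sent to 0. *)
Definition sqnorm f := \int[leb]_x (f x ^+ 2).

Lemma Lnorm_pow2 f : L2 f -> Lnorm_pow 2 f = (sqnorm f)%:E.
Proof.
move=> /L2P[mf intf]; rewrite Lnorm_powE// /sqnorm /Rintegral fineK; last first.
  exact: integrable_fin_num intf.
by apply: eq_integral => x _; rewrite powR_mulrn// real_normK// num_real.
Qed.

Lemma sqnorm_ge0 f : 0 <= sqnorm f.
Proof. by apply: Rintegral_ge0 => x _; exact: sqr_ge0. Qed.

Lemma L2_measurable f : L2 f -> measurable_fun setT f.
Proof. by move=> /L2P[]. Qed.

Lemma L2_sqr f : L2 f -> leb.-integrable setT (EFin \o (fun x => f x ^+ 2)).
Proof. by move=> /L2P[]. Qed.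

Lemma L2M f g : L2 f -> L2 g ->
  leb.-integrable setT (EFin \o (fun x => f x * g x)).
Proof. by move=> Hf Hg; apply/Lfun1_integrable/Lfun2_mul_Lfun1. Qed.

Lemma L2D f g : L2 f -> L2 g -> L2 (fun x => f x + g x).
Proof.
move=> Hf Hg; have Hf' : f \in Lfun leb 2%:E by [].
have Hg' : g \in Lfun leb 2%:E by [].
suff : f \+ g \in Lfun leb 2%:E by [].
by apply: rpredD => //; rewrite lee_fin; lra.
Qed.

Lemma L2Z c f : L2 f -> L2 (fun x => c * f x).
Proof.
move=> /L2P[mf intf]; apply/L2P; split.
  by apply: measurable_funM.
have := integrable_scale (c ^+ 2) measurableT intf.
by apply: eq_integrable => // x _ /=; rewrite exprMn.
Qed.

Lemma sqnormZ c f : L2 f -> sqnorm (fun x => c * f x) = c ^+ 2 * sqnorm f.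
Proof.
move=> Hf; rewrite /sqnorm; under eq_Rintegral do rewrite exprMn.
by rewrite RintegralZl//; exact: L2_sqr.
Qed.

Lemma sqnormDZ c f g : L2 f -> L2 g ->
  sqnorm (fun x => f x + c * g x) =
  sqnorm f + 2 * c * \int[leb]_x (f x * g x) + c ^+ 2 * sqnorm g.
Proof.
move=> Hf Hg; rewrite -sqnormZ// /sqnorm.
have If := L2_sqr Hf; have Ig := L2_sqr (L2Z c Hg); have Ifg := L2M Hf Hg.
have I1 := integrable_scale (2 * c) measurableT Ifg.
rewrite -RintegralZl// -RintegralD// -RintegralD//; last exact: integrable_add.
by apply: eq_Rintegral => x _; ring.
Qed.

(** On a set of finite measure, |f| <= 1 + f^2 is an integrable bound. *)
Lemma L2_integrable_itv f (D : set (measurableTypeR R)) : measurable D -> (leb D < +oo)%E ->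
  L2 f -> leb.-integrable D (EFin \o f).
Proof.
move=> mD Doo Hf.
apply: (@integrable_le _ (measurableTypeR R) R leb D f (fun x => 1 + f x ^+ 2)) => //.
- exact: L2_measurable.
- move=> x _; rewrite -(real_normK (num_real (f x))).
  by have := sqr_ge0 (`|f x| - 1); nra.
- apply: integrable_add => //; last by apply: integrableS (L2_sqr Hf).
  apply/integrableP; split; first exact/measurable_EFinP.
  by under eq_integral do rewrite /= normr1; rewrite integral_cst// mul1e.
Qed.

(** Rises just after a and falls just after b; for N >= 1 and a <= b it vanishes off ]a, b + 1], a
    window that does not depend on N. *)
Definition cutoff N a b x := step (N * (x - a)) - step (N * (x - b)).

Lemma is_derive_cutoff N a b x : is_derive x 1 (cutoff N a b)
  (delta_approx N a x - delta_approx N b x).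
Proof. exact: is_deriveB (is_derive_step N a x) (is_derive_step N b x). Qed.

Lemma cutoff_supp N a b x : 1 <= N -> a <= b -> ~ (`]a, b + 1]%classic x) ->
  cutoff N a b x = 0.
Proof.
move=> N1 ab; rewrite /= in_itv/= => /negP; rewrite negb_and -leNgt -ltNge.
rewrite /cutoff => /orP[xa|xb].
  by rewrite !step_le0 ?subrr//; nra.
by rewrite !step_ge1 ?subrr//; nra.
Qed.

Lemma cutoff_le1 N a b x : `|cutoff N a b x| <= 1.
Proof.
rewrite /cutoff ler_norml; have := step_itv (N * (x - a)).
have := step_itv (N * (x - b)).
by move=> /andP[? ?] /andP[? ?]; apply/andP; split; lra.
Qed.

Lemma C1c_cutoff N a b : 1 <= N -> a <= b -> C1c (cutoff N a b).
Proof.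
move=> N1 ab; split.
- by move=> x; have := is_derive_cutoff N a b x => ?; exact: ex_derive.
- have -> : (cutoff N a b)^`()%classic =
      (fun x => delta_approx N a x - delta_approx N b x).
    apply/funext => x; rewrite derive1E.
    by have := is_derive_cutoff N a b x => ?; exact: derive_val.
  by move=> x; apply: cvgB; exact: continuous_delta_approx.
- apply: (@subclosed_compact _ _ `[a, b + 1]).
  + exact: closed_closure.
  + exact: segment_compact.
  + rewrite closureE; apply: smallest_sub; first exact: interval_closed.
    move=> x /=; apply: contra_neqP => xab; apply: cutoff_supp => // /=.
    by move=> /subset_itv_oc_cc.
Qed.

(** Since [step 0 = 0], each step tends to the indicator of an open half-line; this is why the limit
    excludes a and includes b. *)
Lemma cvg_cutoff a b x : a <= b ->
  cutoff n.+1%:R a b x @[n --> \oo] --> ((x \in `]a, b])%:R : R).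
Proof.
move=> ab; rewrite in_itv/=.
have S c : step (n.+1%:R * (x - c)) @[n --> \oo] --> ((c < x)%R%:R : R).
  have [cx|cx] := ltP c x; last first.
    apply: cvg_near_cst; near=> n; apply: step_le0.
    by rewrite pmulr_rle0// subr_le0.
  apply: cvg_near_cst; near=> n; apply: step_ge1.
  rewrite -ler_pdivrMr ?subr_gt0// div1r.
  near: n; apply: filterS (nbhs_infty_ger (x - c)^-1) => n /= H.
  by rewrite (le_trans H)// ler_nat.
have -> : (a < x <= b)%R%:R = (a < x)%R%:R - (b < x)%R%:R :> R.
  have [ax|ax] := ltP a x; have [xb|xb] := leP x b => //=; rewrite ?subrr ?subr0//.
  by move: (lt_le_trans xb ax) => /(le_lt_trans ab); rewrite ltxx.
by apply: cvgB; exact: S.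
Unshelve. all: by end_near. Qed.

Lemma integrable_supp (D : set (measurableTypeR R)) f : measurable D ->
  (forall x, ~ D x -> f x = 0) -> leb.-integrable D (EFin \o f) ->
  leb.-integrable setT (EFin \o f).
Proof.
move=> mD fD; rewrite (integrable_mkcond _ mD) restrict_EFin.
apply: eq_integrable => // x _ /=; congr EFin.
by rewrite patchE; case: ifPn => // /negP; rewrite inE => /fD ->.
Qed.

Lemma integrable_mul_delta_approx v N a : continuous v -> 0 < N ->
  leb.-integrable setT (EFin \o (fun x => v x * delta_approx N a x)).
Proof.
move=> cv N0; apply: (@integrable_supp `[a, a + N^-1]) => //.
  by move=> x /(delta_approx_supp N0) ->; rewrite mulr0.
apply: continuous_integrable_itv => x.
by apply: cvgM; [exact: cv|exact: continuous_delta_approx].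
Qed.

(** Tested against cutoffs, the left side converges by continuity of v at a and b, the right side by
    domination with |g| on the common window ]a, b + 1]. *)
Lemma weak_derivative_FTC v g a b : continuous v -> L2 g ->
  is_weak_derivative v g -> a <= b ->
  v b - v a = \int[leb]_(x in `]a, b]) g x.
Proof.
move=> cv Hg vg ab.
pose I n := \int[leb]_x (v x * (delta_approx n.+1%:R a x - delta_approx n.+1%:R b x)).
pose J n := \int[leb]_x (g x * cutoff n.+1%:R a b x).
have N1 n : 1 <= n.+1%:R :> R by rewrite ler1n.
have IJ n : I n = - J n.
  rewrite -vg; last exact: C1c_cutoff.
  apply: eq_Rintegral => x _; congr (_ * _); rewrite derive1E.
  by have := is_derive_cutoff n.+1%:R a b x => ?; rewrite derive_val.
have cvI : I n @[n --> \oo] --> v a - v b.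
  have -> : I = (fun n => \int[leb]_x (v x * delta_approx n.+1%:R a x) -
                         \int[leb]_x (v x * delta_approx n.+1%:R b x)).
    apply/funext => n; rewrite -RintegralB//.
    - by apply: eq_Rintegral => x _; rewrite mulrBr.
    - exact: integrable_mul_delta_approx.
    - exact: integrable_mul_delta_approx.
  by apply: cvgB; exact: cvg_Rintegral_mul_delta_approx.
have cvJ : J n @[n --> \oo] --> \int[leb]_(x in `]a, b]) g x.
  have Ig : leb.-integrable `]a, b + 1] (EFin \o (fun x => `|g x|)).
    apply: integrable_norm; apply: L2_integrable_itv => //.
    by rewrite lebesgue_measure_itv/=; case: ifP => _; rewrite ?ltry//.
  have -> : \int[leb]_(x in `]a, b]) g x =
      \int[leb]_(x in `]a, b + 1]) (g x * (x \in `]a, b])%:R).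
    rewrite Rintegral_mkcond [RHS]Rintegral_mkcond; apply: eq_Rintegral => x _.
    rewrite !patchE !mem_setE; case: ifPn => [xab|_].
      rewrite ifT ?mulr1//; move: xab; rewrite !in_itv/= => /andP[-> xb]/=.
      by rewrite (le_trans xb)// lerDl.
    by rewrite mulr0; case: ifP.
  have -> : J = fun n => \int[leb]_(x in `]a, b + 1]) (g x * cutoff n.+1%:R a b x).
    apply/funext => n; rewrite /J (@Rintegral_supp _ `]a, b + 1])//.
    by move=> x xab; rewrite cutoff_supp ?mulr0.
  apply: fine_cvg; rewrite fineK; last first.
    apply: integrable_fin_num => //; apply: integrable_le Ig => //.
      apply: measurable_funM; first exact: L2_measurable.
      rewrite (_ : (fun _ => _) = \1_[set` `]a, b]]); first exact: measurable_indic.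
      by apply/funext => y; rewrite indicE mem_setE.
    by move=> x _; rewrite normrM ler_piMr//; case: (_ \in _); rewrite ?normr1 ?normr0.
  apply: (@dominated_cvg _ _ _ leb `]a, b + 1]%classic _
    (fun n x => (g x * cutoff n.+1%:R a b x)%:E)
    (fun x => (g x * (x \in `]a, b])%:R)%:E) (EFin \o (fun x => `|g x|))) => //.
  - move=> n; apply/measurable_EFinP; apply: measurable_funTS.
    apply: measurable_funM; first exact: L2_measurable.
    apply: continuous_measurable_fun => x; apply: differentiable_continuous.
    have := is_derive_cutoff n.+1%:R a b x => ?.
    by apply/derivable1_diffP; exact: ex_derive.
  - move=> x _; apply: cvg_EFin; first exact: nearW.
    by apply: cvgM; [exact: cvg_cst|exact: cvg_cutoff].
  - by move=> n x _; rewrite abse_EFin lee_fin normrM ler_piMr// cutoff_le1.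
have : - J n @[n --> \oo] --> - \int[leb]_(x in `]a, b]) g x by exact: cvgN.
have <- : I = (fun n => - J n) by apply/funext.
move=> /(cvg_unique _ cvI) => H.
have := H (@Rhausdorff _); move=> {}H; rewrite -[RHS]opprK -H; ring.
Qed.

Lemma lebesgue_itv_lty (b0 b1 : bool) a b :
  (leb [set` Interval (BSide b0 a) (BSide b1 b)] < +oo)%E.
Proof.
by rewrite lebesgue_measure_itv/=; case: ifP => _; rewrite ?ltry// -EFinD ltry.
Qed.

Lemma L2_locally_integrable f : L2 f -> locally_integrable setT f.
Proof.
move=> Hf; split; [exact: L2_measurable|exact: openT|move=> K _ cK].
have /integrableP[_] := L2_integrable_itv (compact_measurable cK)
  (compact_finite_measure cK) Hf.
by [].
Qed.

(** Lebesgue differentiation: on each half-line ]-n, +oo[ the primitive from -n is constant, so f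
    vanishes almost everywhere there; countably many half-lines cover R. *)
Lemma L2_ae_eq0 f : L2 f ->
  (forall a b, a <= b -> \int[leb]_(x in `]a, b]) f x = 0) ->
  {ae leb, forall x, f x = 0}.
Proof.
move=> Hf f0.
have H (n : nat) : {ae leb, forall x, - n%:R < x -> f x = 0}.
  have If y : leb.-integrable [set` Interval (BRight (- n%:R)) (BRight y)] (EFin \o f).
    by apply: L2_integrable_itv => //; exact: lebesgue_itv_lty.
  have := FTC1 If (L2_locally_integrable Hf).
  apply: filterS; first exact: (ae_filter_ringOfSetsType leb).
  move=> x /= Fx xn; have [|_ <-] := Fx; first by rewrite lte_fin.
  rewrite (_ : (fun _ => _) = cst 0); first by rewrite derive1_cst.
  apply/funext => y /=; have [ny|ny] := leP (- n%:R) y; first exact: f0.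
  by rewrite set_itv_ge ?Rintegral_set0// bnd_simp -leNgt ltW.
rewrite /almost_everywhere; apply: negligibleS (negligible_bigcup H) => x /= fx.
exists (Num.bound `|x|) => //= Hx; apply/fx/Hx.
rewrite ltrNl (le_lt_trans (ler_norm _))// normrN.
exact: (archi_boundP (normr_ge0 x)).
Qed.

Lemma continuous_compact_L2 f (D : set R) : continuous f -> compact D ->
  (forall x, ~ D x -> f x = 0) -> L2 f.
Proof.
move=> cf cD fD; apply/L2P; split; first exact: continuous_measurable_fun.
apply: (@integrable_supp D).
- exact: compact_measurable.
- by move=> x /fD ->; rewrite expr0n.
- apply: continuous_compact_integrable => //; apply: continuous_subspaceT => x.
  by rewrite /continuous_at; apply: cvgM; exact: cf.
Qed.

(** Off the closed support [phi] is locally zero, so the derivative vanishes there as well. *)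
Lemma C1c_L2 phi : C1c phi -> L2 phi /\ L2 (phi^`())%classic.
Proof.
move=> [dphi cphi' kphi]; set D := closure _ in kphi.
have phi0 x : ~ D x -> phi x = 0.
  by move=> Dx; apply: contra_notP Dx => /eqP phix; exact: subset_closure.
split.
  apply: (@continuous_compact_L2 _ D) => // x.
  by apply: differentiable_continuous; apply/derivable1_diffP.
apply: (@continuous_compact_L2 _ D) => // x Dx.
have : open (~` D) by apply: closed_openC; exact: closed_closure.
rewrite openE => /(_ _ Dx) nDx.
rewrite derive1E (@near_eq_derive _ _ _ _ (cst 0)) ?derive_cst//.
by near=> y; apply: phi0; near: y.
Unshelve. all: by end_near. Qed.

Lemma is_weak_derivativeD c v w g h : L2 v -> L2 w -> L2 g -> L2 h ->
  is_weak_derivative v g -> is_weak_derivative w h ->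
  is_weak_derivative (fun x => v x + c * w x) (fun x => g x + c * h x).
Proof.
move=> Hv Hw Hg Hh vg wh phi Cphi; have [H0 H1] := C1c_L2 Cphi.
have E f1 f2 k : L2 f1 -> L2 f2 -> L2 k ->
    \int[leb]_x ((f1 x + c * f2 x) * k x) =
    \int[leb]_x (f1 x * k x) + c * \int[leb]_x (f2 x * k x).
  move=> L1 L2' Lk; rewrite -RintegralZl//; last exact: L2M.
  rewrite -RintegralD//.
  - by apply: eq_Rintegral => x _; ring.
  - exact: L2M.
  - by apply: integrable_scale => //; exact: L2M.
by rewrite !E// vg// wh//; ring.
Qed.

Lemma is_weak_derivative0 : is_weak_derivative (fun _ : R => 0) (fun _ => 0).
Proof.
move=> phi _; under eq_Rintegral do rewrite mul0r.
by under [X in _ = - X]eq_Rintegral do rewrite mul0r; rewrite Rintegral_cst// mul0r oppr0.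
Qed.

Lemma L2_0 : L2 (fun _ : R => 0).
Proof.
apply/L2P; split; first exact: measurable_cst.
by under [X in _ _ X]eq_fun do rewrite /= expr0n; exact: integrable0.
Qed.

Lemma L2_sqnorm_ae f g : L2 f -> L2 g -> {ae leb, forall x, f x = g x} ->
  sqnorm f = sqnorm g.
Proof.
move=> Hf Hg fg; rewrite /sqnorm /Rintegral; congr fine.
apply: ae_eq_integral => //.
- by have /integrableP[] := L2_sqr Hf.
- by have /integrableP[] := L2_sqr Hg.
- apply: filterS fg; first exact: (ae_filter_ringOfSetsType leb).
  by move=> x /= -> _.
Qed.

(** Both functions integrate to the same increments of v. The choice made in [weak_derivative]
    therefore does not affect the energy. *)
Lemma sqnorm_weak_derivative_unique v g h : continuous v -> L2 g -> L2 h ->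
  is_weak_derivative v g -> is_weak_derivative v h -> sqnorm g = sqnorm h.
Proof.
move=> cv Hg Hh vg vh; apply: L2_sqnorm_ae => //.
have Hk : L2 (fun x => g x + (-1) * h x) by apply: L2D => //; exact: L2Z.
have := L2_ae_eq0 Hk; set P := (X in (X -> _) -> _); have HP : P.
  move=> a b ab.
  have Ig := L2_integrable_itv _ (lebesgue_itv_lty false false a b) Hg.
  have Ih := L2_integrable_itv _ (lebesgue_itv_lty false false a b) Hh.
  rewrite RintegralD//.
  - rewrite RintegralZl ?mulN1r//; last exact: Ih.
    by rewrite -!(@weak_derivative_FTC v)// subrr.
  - exact: Ig.
  - by apply: integrable_scale => //; exact: Ih.
move=> /(_ HP); apply: filterS; first exact: (ae_filter_ringOfSetsType leb).
by move=> x /= /eqP; rewrite mulN1r subr_eq0 => /eqP.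
Qed.

Lemma H1_intro v g : continuous v -> L2 v -> L2 g -> is_weak_derivative v g ->
  H1 v.
Proof. by move=> cv Hv Hg vg; split => //; exists g. Qed.

Lemma weak_derivativeP v : H1 v ->
  L2 (weak_derivative v) /\ is_weak_derivative v (weak_derivative v).
Proof.
move=> [_ _ [g Hg vg]]; rewrite /weak_derivative.
by case: xgetP => [h _ //|/(_ g)/=]; case.
Qed.

Lemma Lnorm_pow_weak_derivative v g : continuous v -> L2 v -> L2 g ->
  is_weak_derivative v g -> Lnorm_pow 2 (weak_derivative v) = (sqnorm g)%:E.
Proof.
move=> cv Hv Hg vg; have [Hw vw] := weak_derivativeP (H1_intro cv Hv Hg vg).
by rewrite Lnorm_pow2//; congr EFin; exact: (@sqnorm_weak_derivative_unique v).
Qed.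

End WeakDerivative.

(** * Trace inequalities *)

Section Inequalities.
Context {R : realType}.
Implicit Types (f g v : R -> R) (a b x y lam p s w : R).
Local Notation leb := (@lebesgue_measure R).

Lemma ge0_subset_Rintegral (A B : set (measurableTypeR R)) f :
  measurable A -> measurable B -> A `<=` B ->
  (forall x, 0 <= f x) -> leb.-integrable B (EFin \o f) ->
  \int[leb]_(x in A) f x <= \int[leb]_(x in B) f x.
Proof.
move=> mA mB AB f0 If; rewrite /Rintegral fine_le//.
- by apply: integrable_fin_num => //; exact: integrableS If.
- exact: integrable_fin_num If.
- apply: ge0_subset_integral => //; first by have /integrableP[] := If.
  by move=> x _; rewrite lee_fin.
Qed.

Lemma Rintegral_cst_itv a b c : a <= b ->
  \int[leb]_(x in `]a, b]) c = c * (b - a).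
Proof.
move=> ab.
have E : leb `]a, b] = (b - a)%:E.
  rewrite lebesgue_measure_itv/= lte_fin.
  have [//|ba] := ltP a b; have -> : a = b by apply/le_anti; rewrite ab ba.
  by rewrite subrr.
by rewrite Rintegral_cst//= E.
Qed.

Lemma integrable_cst_itv a b c :
  leb.-integrable `]a, b] (EFin \o (fun=> c)).
Proof.
apply/integrableP; split; first exact/measurable_EFinP.
rewrite integral_cst//= lte_mul_pinfty//; exact: lebesgue_itv_lty.
Qed.

Lemma integrable_itvS (i : interval R) f :
  leb.-integrable setT (EFin \o f) -> leb.-integrable [set` i] (EFin \o f).
Proof. by move=> If; apply: integrableS If. Qed.

(** Finitely many steps of length at most h lead from x to y; estimates valid on short intervals
    thus become global. *)
Lemma local_monotone f (h : R) : 0 < h ->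
  (forall x y, x <= y <= x + h -> f x <= f y) ->
  forall x y, x <= y -> f x <= f y.
Proof.
move=> h0 fh x y xy.
have H (n : nat) : forall z, x <= z <= x + n%:R * h -> f x <= f z.
  elim: n => [z|n IH z /andP[xz zn]].
    by rewrite mul0r addr0 => /le_anti ->.
  have [zh|zh] := leP z (x + h); first by apply: fh; rewrite xz.
  apply: (@le_trans _ _ (f (z - h))); last by apply: fh; rewrite subrK; lra.
  by apply: IH; apply/andP; split; move: zn; rewrite -natr1; nra.
apply: (H (Num.bound ((y - x) / h))); rewrite xy/= -lerBlDl -ler_pdivrMr//.
by rewrite ltW// archi_boundP// divr_ge0 ?subr_ge0// ltW.
Qed.

Section Increments.
Variables v g : R -> R.
Hypotheses (cv : continuous v) (Hv : L2 v) (Hg : L2 g)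
  (vg : is_weak_derivative v g).

(* Cauchy-Schwarz in the form of Young's inequality, with a free parameter. *)
Lemma weak_derivative_increment a b s : a <= b -> 0 < s ->
  `|v b - v a| <= (s * (b - a) + sqnorm g / s) / 2.
Proof.
move=> ab s0; rewrite (weak_derivative_FTC cv Hg vg ab).
have Ig : leb.-integrable `]a, b] (EFin \o g).
  by apply: L2_integrable_itv => //; exact: lebesgue_itv_lty.
apply: le_trans (le_normr_Rintegral _ Ig) _ => //.
have I2 := integrable_itvS `]a, b] (L2_sqr Hg).
have I2' : leb.-integrable `]a, b] (EFin \o (fun x => s^-1 / 2 * g x ^+ 2)).
  exact: integrable_scale.
apply: (@le_trans _ _ (\int[leb]_(x in `]a, b]) (s / 2 + s^-1 / 2 * g x ^+ 2))).
  apply: le_Rintegral => //.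
  - exact: integrable_norm.
  - by apply: integrable_add => //; exact: integrable_cst_itv.
  - move=> x _; rewrite -(real_normK (num_real (g x))).
    rewrite -(ler_pM2l s0) mulrDr !mulrA mulfV ?gt_eqF//.
    by have := sqr_ge0 (`|g x| - s); nra.
rewrite RintegralD//; last exact: integrable_cst_itv.
rewrite Rintegral_cst_itv// RintegralZl//.
have : \int[leb]_(x in `]a, b]) (g x ^+ 2) <= sqnorm g.
  by apply: ge0_subset_Rintegral => //; [move=> x; exact: sqr_ge0|exact: L2_sqr].
have si : 0 < s^-1 by rewrite invr_gt0.
move: (\int[_]_(_ in _) _) => J; nra.
Qed.

Lemma small_increment w : 0 < w ->
  exists2 h, 0 < h & forall x y, x <= y <= x + h -> `|v y - v x| <= w.
Proof.
move=> w0; have K0 := sqnorm_ge0 g.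
(* This makes [sqnorm g / s] at most w, and the length w / s does the same for [s * (y - x)]; the
   [+ 1] keeps s positive when g has zero norm. *)
pose s := (sqnorm g + 1) / w; have s0 : 0 < s by rewrite divr_gt0// ltr_wpDl.
exists (w / s); first by rewrite divr_gt0.
move=> x y /andP[xy yx]; have := weak_derivative_increment xy s0.
move=> /le_trans; apply.
have H1 : s * (y - x) <= w.
  by rewrite mulrC -ler_pdivlMr//; lra.
have H2 : sqnorm g / s <= w.
  rewrite ler_pdivrMr// /s mulrCA mulfV ?gt_eqF// mulr1; lra.
lra.
Qed.

(* On short intervals |v^2(y) - v^2(x)| is bounded by the increment of
   [A], the primitive of 2 |v v'| + w (v'^2 + 1), so [A - v^2] and [A + v^2]
   are nondecreasing; then w tends to 0. *)
Lemma sqr_increment a b : a <= b ->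
  `|v b ^+ 2 - v a ^+ 2| <= 2 * \int[leb]_(x in `]a, b]) `|v x * g x|.
Proof.
move=> ab.
have Ivg := L2M Hv Hg; have Ig := L2_sqr Hg.
have Ivg' : leb.-integrable setT (EFin \o (fun x => `|v x * g x|)).
  exact: integrable_norm.
have B w : 0 < w -> `|v b ^+ 2 - v a ^+ 2| <=
    2 * (\int[leb]_(x in `]a, b]) `|v x * g x|) + w * (sqnorm g + (b - a)).
  move=> w0; have [h h0 vh] := small_increment w0.
  pose k x := 2 * `|v x * g x| + w * g x ^+ 2.
  have Ik : leb.-integrable setT (EFin \o k).
    by apply: integrable_add => //; exact: integrable_scale.
  pose A x := \int[leb]_(t in `]-oo, x]) k t + w * x.
  have AE x y : x <= y -> A y - A x = \int[leb]_(t in `]x, y]) k t + w * (y - x).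
    move=> xy; rewrite -(@Rintegral_itvB _ k -oo%O (BRight y) x)//; first by rewrite /A; ring.
    exact: integrable_itvS.
  have loc x y : x <= y <= x + h -> `|v y ^+ 2 - v x ^+ 2| <= A y - A x.
    move=> /andP[xy yx]; rewrite AE//.
    rewrite subr_sqr (weak_derivative_FTC cv Hg vg xy).
    have Igx : leb.-integrable `]x, y] (EFin \o g).
      by apply: L2_integrable_itv => //; exact: lebesgue_itv_lty.
    rewrite mulrC -RintegralZl//.
    have Igx' : leb.-integrable `]x, y] (EFin \o (fun t => (v y + v x) * g t)).
      exact: integrable_scale.
    apply: le_trans (le_normr_Rintegral _ Igx') _ => //.
    rewrite -Rintegral_cst_itv// -RintegralD//; last 2 first.
    - exact: integrable_itvS.
    - exact: integrable_cst_itv.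
    apply: le_Rintegral => //.
    - exact: integrable_norm.
    - by apply: integrable_add => //; [exact: integrable_itvS|exact: integrable_cst_itv].
    - move=> t; rewrite /= in_itv/= => /andP[xt ty].
      (* Replacing v y and v x by v t costs w each; the resulting 2 w |g t| is at most w (g t^2 +
         1). *)
      have H1 : `|v y - v t| <= w by apply: vh; lra.
      have H2 : `|v t - v x| <= w by apply: vh; lra.
      rewrite /k !normrM.
      have H3 : `|v y + v x| <= 2 * `|v t| + 2 * w.
        move: H1 H2; rewrite !ler_norml => /andP[? ?] /andP[? ?].
        have := ler_norm (v t); have := ler_norm (- v t); rewrite normrN => ? ?.
        by apply/andP; split; lra.
      rewrite -(real_normK (num_real (g t))).
      apply: le_trans (ler_wpM2r (normr_ge0 _) H3) _.
      by have := sqr_ge0 (`|g t| - 1); nra.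
  have M1 : A a - v a ^+ 2 <= A b - v b ^+ 2.
    apply: (@local_monotone (fun x => A x - v x ^+ 2) h) => // x y /loc.
    by rewrite ler_norml => /andP[? ?]; lra.
  have M2 : A a + v a ^+ 2 <= A b + v b ^+ 2.
    apply: (@local_monotone (fun x => A x + v x ^+ 2) h) => // x y /loc.
    by rewrite ler_norml => /andP[? ?]; lra.
  have : A b - A a <= 2 * (\int[leb]_(x in `]a, b]) `|v x * g x|) + w * (sqnorm g + (b - a)).
    rewrite AE// RintegralD//; last 2 first.
    - by apply: integrable_itvS; exact: integrable_scale.
    - by apply: integrable_itvS; exact: integrable_scale.
    rewrite !RintegralZl//; last 2 first.
    - exact: integrable_itvS.
    - exact: integrable_itvS.
    have : \int[leb]_(x in `]a, b]) (g x ^+ 2) <= sqnorm g.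
      by apply: ge0_subset_Rintegral => // x; exact: sqr_ge0.
    move: (\int[_]_(_ in _) (_ ^+ 2)) => J; nra.
  move=> H; rewrite ler_norml; apply/andP; split; lra.
apply/ler_addgt0Pr => e e0.
have D0 : 0 < sqnorm g + (b - a) + 1.
  by have := sqnorm_ge0 g; lra.
apply: le_trans (B (e / (sqnorm g + (b - a) + 1)) _) _; first by rewrite divr_gt0.
rewrite lerD2l mulrAC ler_pdivrMr// ler_pM2l//; lra.
Qed.

(** Otherwise v^2 > e on an interval of length L, too much for the mass. This stands in for decay of
    v at infinity. *)
Lemma L2_small_value (e a L : R) : 0 < e -> sqnorm v < e * L -> 0 < L ->
  exists2 x, a < x <= a + L & v x ^+ 2 <= e.
Proof.
move=> e0 eL L0; apply: contrapT => H.
have : e * L <= sqnorm v.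
  have aL : a <= a + L by rewrite lerDl ltW.
  rewrite -{1}(addrK a L) (addrC L) -Rintegral_cst_itv//.
  apply: (@le_trans _ _ (\int[leb]_(x in `]a, a + L]) (v x ^+ 2))).
    apply: le_Rintegral => //.
    - exact: integrable_cst_itv.
    - by apply: integrable_itvS; exact: L2_sqr.
    - move=> x; rewrite /= in_itv/= => xa.
      by rewrite leNgt; apply/negP => /ltW vx; apply: H; exists x.
  apply: ge0_subset_Rintegral => //; first by move=> x; exact: sqr_ge0.
  exact: L2_sqr.
by rewrite leNgt eL.
Qed.

(** Going from 0 to a point where v is small, once to the right and once to the left, bounds v(0)^2
    twice by 2 |v v'| integrated over disjoint intervals. The sum gives v(0)^2 <= ||v v'||_1 with
    the sharp constant, and Young's inequality concludes. *)
Lemma trace_inequality lam : 0 < lam ->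
  2 * lam * v 0 ^+ 2 <= lam ^+ 2 * sqnorm v + sqnorm g.
Proof.
move=> l0.
have Ivg := L2M Hv Hg; have Ig := L2_sqr Hg; have Iv := L2_sqr Hv.
have Ivg' : leb.-integrable setT (EFin \o (fun x => `|v x * g x|)).
  exact: integrable_norm.
have H : v 0 ^+ 2 <= \int[leb]_x `|v x * g x|.
  apply/ler_addgt0Pr => e e0.
  pose L := (sqnorm v + 1) / e.
  have L0 : 0 < L by rewrite divr_gt0// ltr_wpDl// sqnorm_ge0.
  have eL : sqnorm v < e * L by rewrite /L mulrC divfK ?gt_eqF// ltrDl.
  have [x1] := L2_small_value 0 e0 eL L0; rewrite add0r => /andP[x10 _] v1.
  have [x2] := L2_small_value (- L) e0 eL L0; rewrite addNr => /andP[_ x20] v2.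
  have := sqr_increment (ltW x10); have := sqr_increment x20.
  have <- : \int[leb]_(x in `]x2, x1]) `|v x * g x| -
      \int[leb]_(x in `]x2, 0]) `|v x * g x| = \int[leb]_(x in `]0, x1]) `|v x * g x|.
    apply: (@Rintegral_itvB _ _ (BRight x2) (BRight x1)) => //.
    - exact: integrable_itvS.
    - by rewrite bnd_simp ltW.
  have : \int[leb]_(x in `]x2, x1]) `|v x * g x| <= \int[leb]_x `|v x * g x|.
    by apply: ge0_subset_Rintegral.
  move: (\int[leb]_(x in `]x2, x1]) _) (\int[leb]_(x in `]x2, 0]) _) => J1 J2 HJ.
  rewrite !ler_norml => /andP[? ?] /andP[? ?]; lra.
have H2 : 2 * lam * \int[leb]_x `|v x * g x| <= lam ^+ 2 * sqnorm v + sqnorm g.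
  rewrite /sqnorm -!RintegralZl//.
  rewrite -RintegralD//; last exact: integrable_scale.
  apply: le_Rintegral => //.
  - exact: integrable_scale.
  - by apply: integrable_add => //; exact: integrable_scale.
  - move=> x _; rewrite normrM -(real_normK (num_real (g x))) -(real_normK (num_real (v x))).
    by have := sqr_ge0 (lam * `|v x| - `|g x|); nra.
by apply: le_trans H2; rewrite ler_pM2l// mulr_gt0.
Qed.

Lemma trace_inequality4 (nu : R) : 0 < nu -> sqnorm v <= nu ->
  `|v 0| ^+ 4 <= nu * sqnorm g.
Proof.
move=> nu0 vnu; have [->|v0] := eqVneq (v 0) 0.
  by rewrite normr0 expr0n mulr_ge0 ?sqnorm_ge0// ltW.
have t0 : 0 < v 0 ^+ 2 by rewrite exprn_even_gt0.
(* The rate of the exponential with height |v 0| and mass nu, the equality case. *)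
have l0 : 0 < v 0 ^+ 2 / nu by rewrite divr_gt0.
have := trace_inequality l0.
rewrite -(ler_pM2l nu0).
have -> : nu * (2 * (v 0 ^+ 2 / nu) * v 0 ^+ 2) = 2 * `|v 0| ^+ 4.
  by rewrite (exprM `|v 0| 2 2) real_normK ?num_real//; field; rewrite gt_eqF.
rewrite mulrDr.
have : nu * ((v 0 ^+ 2 / nu) ^+ 2 * sqnorm v) <= `|v 0| ^+ 4.
  rewrite (exprM `|v 0| 2 2) real_normK ?num_real//.
  rewrite (_ : nu * _ = (v 0 ^+ 2) ^+ 2 * (sqnorm v / nu)); last by field; rewrite gt_eqF.
  by rewrite ler_piMr ?sqr_ge0// ler_pdivrMr// mul1r.
move: (nu * (_ * _)) => z; lra.
Qed.

(* If ||v'||^2 < |v 0|^r with r = p/2+1, then |v| >= |v 0| / 2 on an interval of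
   length d = |v 0|^2 / (4 |v 0|^r), which bounds ||v||_p^p from below. *)
Lemma trace_inequality_p p : 2 < p ->
  leb.-integrable setT (EFin \o (fun x => `|v x| `^ p)) ->
  2 `^ (- p - 2) / p * `|v 0| `^ (p / 2 + 1) <=
  sqnorm g / 2 + p^-1 * \int[leb]_x (`|v x| `^ p).
Proof.
move=> p2 Ip; set t := `|v 0|; set r := p / 2 + 1.
have p0 : 0 < p by lra.
have P0 : 0 <= \int[leb]_x (`|v x| `^ p) by apply: Rintegral_ge0 => x _; exact: powR_ge0.
have [t0|t0] := eqVneq t 0.
  rewrite t0 powR0 ?mulr0; last by rewrite gt_eqF// /r; lra.
  by rewrite addr_ge0 ?divr_ge0 ?mulr_ge0 ?sqnorm_ge0// invr_ge0 ltW.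
have {}t0 : 0 < t by rewrite lt_neqAle eq_sym t0 normr_ge0.
have tr0 : 0 < t `^ r by rewrite powR_gt0.
(* In the first case the kinetic term alone suffices: the constant is at most 1/p, hence at most
   1/2. *)
have [Kt|Kt] := leP (t `^ r) (sqnorm g).
  apply: (@le_trans _ _ (sqnorm g / 2)); last by rewrite lerDl mulr_ge0// invr_ge0 ltW.
  rewrite mulrC ler_pM// ?powR_ge0//; first by rewrite divr_ge0 ?powR_ge0// ltW.
  rewrite ler_pdivrMr//; apply: (@le_trans _ _ 1); last by lra.
  by have := @ler_powR _ 2 _ (- p - 2) 0; rewrite powRr0; apply; lra.
apply: (@le_trans _ _ (p^-1 * \int[leb]_x (`|v x| `^ p))); last first.
  by rewrite lerDr divr_ge0// sqnorm_ge0.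
rewrite mulrAC mulrC ler_pM2l ?invr_gt0//.
pose d := t ^+ 2 / (4 * t `^ r).
have d0 : 0 < d by rewrite divr_gt0 ?exprn_gt0// mulr_gt0.
have vd x : 0 < x <= d -> t / 2 <= `|v x|.
  (* With this Young parameter both terms of the increment bound are at most t/2 on ]0, d]. *)
  move=> /andP[x0 xd]; have s0 : 0 < 2 * t `^ r / t by rewrite divr_gt0// mulr_gt0.
  have := weak_derivative_increment (ltW x0) s0.
  have H1 : 2 * t `^ r / t * (x - 0) <= t / 2.
    rewrite subr0 mulrC -ler_pdivlMr// (le_trans xd)// le_eqVlt; apply/orP; left.
    by apply/eqP; rewrite /d; field; rewrite !gt_eqF.
  have H2 : sqnorm g / (2 * t `^ r / t) <= t / 2.
    rewrite ler_pdivrMr// (_ : t / 2 * _ = t `^ r) ?ltW//.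
    by field; rewrite gt_eqF.
  move=> H3; have := ler_normD (v x) (v 0 - v x); rewrite addrC subrK -/t distrC.
  lra.
apply: (@le_trans _ _ (\int[leb]_(x in `]0, d]) (`|v x| `^ p))); last first.
  by apply: ge0_subset_Rintegral => //; move=> x; exact: powR_ge0.
apply: (@le_trans _ _ (\int[leb]_(x in `]0, d]) ((t / 2) `^ p))); last first.
  apply: le_Rintegral => //.
  - exact: integrable_cst_itv.
  - exact: integrable_itvS.
  - move=> x; rewrite /= in_itv/= => /vd tv.
    by rewrite ge0_ler_powR ?nnegrE ?divr_ge0 ?normr_ge0// ltW.
rewrite Rintegral_cst_itv ?(ltW d0)// subr0 /d.
rewrite le_eqVlt; apply/orP; left; apply/eqP.
have t0' := ltW t0.
have E1 : 2 `^ (- p - 2) = (2^-1) `^ p / 4 :> R.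
  rewrite powRB; last by apply/implyP.
  rewrite -[2^-1]powR_inv1// -powRrM mulN1r (_ : 4 = 2 `^ 2)//.
  by rewrite powR_mulrn//; ring.
(* The exponent r is the one with 2 r - 2 = p, so that d t^p = t^r / 4; this 1/4 and the factor
   2^(-p) of (t/2)^p make up the constant. *)
have E2 : t `^ p = t `^ r * t `^ r / t ^+ 2.
  rewrite -powR_mulrn// -powRD; last by apply/implyP => _; rewrite gt_eqF.
  rewrite -powRB; last by apply/implyP => _; rewrite gt_eqF.
  by congr (_ `^ _); rewrite /r; field.
by rewrite powRM ?invr_ge0// E1 E2; field; rewrite !gt_eqF.
Qed.

End Increments.

End Inequalities.

(** * The exponential profile *)

Section Peak.
Context {R : realType}.
Implicit Types (A lam x r p : R) (f : R -> R).
Local Notation leb := (@lebesgue_measure R).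

Definition peak A lam x := A * expR (- lam * `|x|).

Definition peak_slope A lam x := (if x < 0 then lam else - lam) * peak A lam x.

Lemma continuous_expRabs lam : continuous (fun x => expR (- lam * `|x|)).
Proof.
move=> x; apply: (@continuous_comp _ _ _ (fun x => - lam * `|x|) expR).
  by apply: cvgM; [exact: cvg_cst|exact: norm_continuous].
exact: continuous_expR.
Qed.

Lemma continuous_peak A lam : continuous (peak A lam).
Proof.
by move=> x; apply: cvgM; [exact: cvg_cst|exact: continuous_expRabs].
Qed.

Lemma integral_expRabs lam : 0 < lam ->
  (\int[leb]_x (expR (- lam * `|x|))%:E = (2 / lam)%:E)%E.
Proof.
move=> l0; rewrite ge0_symfun_integralT; last 3 first.
- by move=> x; exact: expR_ge0.
- exact: continuous_expRabs.
- by move=> x /=; rewrite normrN.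
have -> : [set x : R | (0 <= x)%R] = `[0, +oo[%classic.
  by apply/seteqP; split => x /=; rewrite in_itv/= andbT.
rewrite EFinM; congr (_ * _)%E.
rewrite (@ge0_continuous_FTC2y _ _ (fun x => - lam^-1 * expR (- lam * x)) 0 0).
- by rewrite mulr0 expR0 mulr1 -EFinB sub0r opprK.
- by move=> x _; exact: expR_ge0.
- exact/continuous_subspaceT/continuous_expRabs.
- rewrite -[X in _ --> X](mulr0 (- lam^-1)); apply: cvgM; first exact: cvg_cst.
  under eq_cvg do rewrite mulNr.
  apply: (@cvg_comp _ _ _ (fun x => lam * x) (fun y => expR (- y)) _ (pinfty_nbhs R)).
  + by apply: gt0_cvgMry => //; exact: cvg_id.
  + exact: cvgr_expR.
- by move=> x _; exact: ex_derive.
- apply: cvg_at_right_filter; apply: cvgM; first exact: cvg_cst.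
  apply: (@continuous_comp _ _ _ (fun x => - lam * x) expR).
    by apply: cvgM; [exact: cvg_cst|exact: cvg_id].
  exact: continuous_expR.
- move=> x; rewrite in_itv/= andbT => x0; rewrite derive1E derive_val /=.
  rewrite gtr0_norm//.
  by rewrite /GRing.scale/=; field; rewrite gt_eqF.
Qed.

Lemma Lnorm_pow_peak r A lam : 0 < r -> 0 < lam ->
  Lnorm_pow r (peak A lam) = (`|A| `^ r * (2 / (r * lam)))%:E.
Proof.
move=> r0 l0; rewrite Lnorm_powE//.
have rl0 : 0 < r * lam by rewrite mulr_gt0.
rewrite EFinM -integral_expRabs//.
have mE : measurable_fun setT (fun x => (expR (- (r * lam) * `|x|))%:E).
  apply/measurable_EFinP; apply: continuous_measurable_fun.
  exact: continuous_expRabs.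
under eq_integral => x _.
  rewrite /peak normrM powRM// (ger0_norm (expR_ge0 _)) -expRM.
  rewrite (_ : - lam * `|x| * r = - (r * lam) * `|x|); last by ring.
  by rewrite EFinM; over.
by rewrite ge0_integralZl_EFin ?powR_ge0// => x _; rewrite lee_fin expR_ge0.
Qed.

Lemma L2_peak A lam : 0 < lam -> L2 (peak A lam).
Proof.
move=> l0; apply/L2P; split.
  by apply: continuous_measurable_fun; exact: continuous_peak.
apply/integrableP; split.
  apply/measurable_EFinP; apply: measurable_funX.
  by apply: continuous_measurable_fun; exact: continuous_peak.
have := @Lnorm_pow_peak 2 A lam; rewrite Lnorm_powE// => /(_ _ l0) H.
under eq_integral do rewrite /= normrX -powR_mulrn//.
by rewrite H// ltry.
Qed.

Lemma sqnorm_peak A lam : 0 < lam -> sqnorm (peak A lam) = A ^+ 2 / lam.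
Proof.
move=> l0; apply: EFin_inj; rewrite -Lnorm_pow2; last exact: L2_peak.
rewrite Lnorm_pow_peak// powR_mulrn// real_normK ?num_real//; congr EFin.
by field; rewrite gt_eqF.
Qed.

Lemma measurable_peak_slope A lam : measurable_fun setT (peak_slope A lam).
Proof.
apply: measurable_funM; last first.
  by apply: continuous_measurable_fun; exact: continuous_peak.
rewrite (_ : (fun x => if x < 0 then lam else - lam) = (fun x => lam * (2 * \1_(`]-oo, 0[) x - 1))).
  apply: measurable_funM; first exact: measurable_cst.
  apply: measurable_funB; last exact: measurable_cst.
  by apply: measurable_funM; [exact: measurable_cst|exact: measurable_indic].
apply/funext => x; rewrite indicE mem_setE in_itv/=.
by case: ifP => _ /=; ring.
Qed.

Lemma sqr_peak_slope A lam x :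
  peak_slope A lam x ^+ 2 = (lam * peak A lam x) ^+ 2.
Proof. by rewrite /peak_slope; case: ifP => _; ring. Qed.

Lemma L2_peak_slope A lam : 0 < lam -> L2 (peak_slope A lam).
Proof.
move=> l0; apply/L2P; split; first exact: measurable_peak_slope.
have /L2P[_] := L2Z lam (L2_peak A l0).
by apply: eq_integrable => // x _ /=; rewrite sqr_peak_slope.
Qed.

Lemma sqnorm_peak_slope A lam : 0 < lam ->
  sqnorm (peak_slope A lam) = lam * A ^+ 2.
Proof.
move=> l0; rewrite (_ : sqnorm _ = sqnorm (fun x => lam * peak A lam x)).
  by rewrite sqnormZ ?sqnorm_peak//; [field; rewrite gt_eqF|exact: L2_peak].
by apply: eq_Rintegral => x _; exact: sqr_peak_slope.
Qed.

Lemma continuous_expR_parts (c A : R) (phi : R -> R) :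
  (forall x, derivable phi x 1) -> continuous (phi^`())%classic ->
  continuous (fun x => A * expR (c * x) * (phi^`())%classic x +
                       c * (A * expR (c * x)) * phi x).
Proof.
move=> dphi cphi'.
have cphi : continuous phi.
  by move=> x; apply: differentiable_continuous; apply/derivable1_diffP.
have ce : continuous (fun x => A * expR (c * x)).
  move=> x; apply: cvgM; first exact: cvg_cst.
  apply: (@continuous_comp _ _ _ (fun x => c * x) expR).
    by apply: cvgM; [exact: cvg_cst|exact: cvg_id].
  exact: continuous_expR.
move=> x; apply: cvgD; apply: cvgM.
- exact: ce.
- exact: cphi'.
- by apply: cvgM; [exact: cvg_cst|exact: ce].
- exact: cphi.
Qed.

(** To be used with c = lam to the left of the kink and c = - lam to its right. *)
Lemma Rintegral_expR_parts (c A a b : R) (phi : R -> R) : a < b ->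
  (forall x, derivable phi x 1) -> continuous (phi^`())%classic ->
  \int[leb]_(x in `[a, b]) (A * expR (c * x) * (phi^`())%classic x +
                           c * (A * expR (c * x)) * phi x) =
  A * expR (c * b) * phi b - A * expR (c * a) * phi a.
Proof.
move=> ab dphi cphi'.
pose F x := A * expR (c * x) * phi x.
have dF x : is_derive x 1 F (A * expR (c * x) * (phi^`())%classic x +
    c * (A * expR (c * x)) * phi x).
  have dp : is_derive x 1 phi ((phi^`())%classic x).
    by rewrite derive1E; exact: DeriveDef.
  by apply: is_derive_eq; rewrite /GRing.scale/=; ring.
rewrite /Rintegral (@continuous_FTC2 _ _ F)//.
- exact/continuous_subspaceT/continuous_expR_parts.
- have cF : continuous F.
    move=> x; have := dF x => ?; apply: differentiable_continuous.
    by apply/derivable1_diffP; exact: ex_derive.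
  split.
  + by move=> x _; have := dF x => ?; exact: ex_derive.
  + exact/cvg_at_right_filter/cF.
  + exact/cvg_at_left_filter/cF.
- by move=> x _; rewrite derive1E; have := dF x => ?; rewrite derive_val.
Qed.

(** Integration by parts on each side of 0: the outer boundary terms vanish with [phi], and the two
    terms [A * phi 0] cancel because the peak is continuous. *)
Lemma weak_derivative_peak A lam : 0 < lam ->
  is_weak_derivative (peak A lam) (peak_slope A lam).
Proof.
move=> l0 phi Cphi; have [Hphi Hphi'] := C1c_L2 Cphi.
have [dphi cphi' kphi] := Cphi.
have [M0 [_ HM0]] := compact_bounded kphi.
(* The support lies within distance [|M0| + 1] of 0, so [phi] is already 0 at the endpoints M and -
   M. *)
pose M := `|M0| + 2.
have M0' : 0 < M by rewrite ltr_wpDl.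
have phi0 x : M <= `|x| -> phi x = 0.
  move=> Mx; apply: contrapT => /eqP phix.
  have M1 : M0 < `|M0| + 1 by rewrite (le_lt_trans (ler_norm M0)) ?ltrDl.
  have := HM0 _ M1 _ (subset_closure (phix : [set x | phi x != 0] x)) => /=.
  by move=> /(le_trans Mx); rewrite /M; lra.
have I1 := L2M (L2_peak A l0) Hphi'; have I2 := L2M (L2_peak_slope A l0) Hphi.
pose H x := peak A lam x * (phi^`())%classic x + peak_slope A lam x * phi x.
have IH : leb.-integrable setT (EFin \o H) by exact: integrable_add.
apply/eqP; rewrite -subr_eq0 opprK -RintegralD//; apply/eqP.
have phi'0 x : M < `|x| -> (phi^`())%classic x = 0.
  move=> Mx; rewrite derive1E (@near_eq_derive _ _ _ _ (cst 0)) ?derive_cst//.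
  near=> y; apply: phi0; near: y.
  have : open [set y : R | M < `|y|].
    apply: (@open_comp _ _ (fun y : R => `|y|) [set z | M < z]).
      by move=> y _; exact: (@norm_continuous _ R^o y).
    exact: open_gt.
  by rewrite openE => /(_ _ Mx); apply: filterS => y /= /ltW.
rewrite (@Rintegral_supp _ `[- M, M]); last first.
  move=> x; rewrite /= in_itv/= -ler_norml => /negP; rewrite -ltNge => Mx.
  by rewrite (phi0 _ (ltW Mx)) phi'0// !mulr0 addr0.
rewrite -/H; have E : \int[leb]_(x in `[- M, M]) H x =
    \int[leb]_(x in `[- M, 0]) H x + \int[leb]_(x in `]0, M]) H x.
  rewrite -(@Rintegral_itvB _ H (BLeft (- M)) (BRight M) 0)//; first by ring.
  - exact: integrable_itvS.
  - by rewrite bnd_simp oppr_le0 ltW.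
  - by rewrite bnd_simp ltW.
have E1 : \int[leb]_(x in `[- M, 0]) H x = A * phi 0.
  (* The endpoint 0 is removed, since [peak_slope] takes there the value of the right branch. *)
  rewrite -Rintegral_itv_bndo_bndc; last exact: integrable_itvS.
  have -> : A * phi 0 = \int[leb]_(x in `[- M, 0])
     (A * expR (lam * x) * (phi^`())%classic x + lam * (A * expR (lam * x)) * phi x).
    rewrite Rintegral_expR_parts// ?oppr_lt0// mulr0 expR0 mulr1.
    by rewrite (phi0 (- M)) ?mulr0 ?subr0// normrN ger0_norm// ltW.
  rewrite -Rintegral_itv_bndo_bndc; last first.
    apply: integrableS (@continuous_integrable_itv _ _ (- M) 0 _) => //.
      exact: subset_itv_co_cc.
    exact: continuous_expR_parts.
  apply: eq_Rintegral => x; rewrite inE/= in_itv/= => /andP[_ x0].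
  by rewrite /H /peak_slope /peak x0 ltr0_norm// mulrNN.
have E2 : \int[leb]_(x in `]0, M]) H x = - (A * phi 0).
  have -> : - (A * phi 0) = \int[leb]_(x in `[0, M])
     (A * expR (- lam * x) * (phi^`())%classic x + - lam * (A * expR (- lam * x)) * phi x).
    rewrite Rintegral_expR_parts// mulr0 expR0 mulr1.
    by rewrite (phi0 M) ?mulr0 ?sub0r// ger0_norm// ltW.
  rewrite Rintegral_itv_obnd_cbnd; last exact: integrable_itvS.
  apply: eq_Rintegral => x; rewrite inE/= in_itv/= => /andP[x0 _].
  by rewrite /H /peak_slope /peak ltNge x0/= ger0_norm.
by rewrite E E1 E2 addrN.
Unshelve. all: by end_near. Qed.

End Peak.

(** * The ground level through finite-energy functions *)

Section GroundLevelBounds.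
Context {R : realType}.
Implicit Types (A lam x r p q K P t mu nu : R) (v g f : R -> R).
Local Notation leb := (@lebesgue_measure R).

(* [v] is in H^1(R) with mass [mu], ||v'||^2 = [K] and ||v||_p^p = [P] finite. *)
Definition H1_data p v mu K P := exists g,
  [/\ continuous v, L2 v, L2 g, is_weak_derivative v g &
      [/\ sqnorm v = mu, sqnorm g = K & Lnorm_pow p v = P%:E]].

Definition energy_value p q K P t := 2^-1 * K + p^-1 * P - q^-1 * t `^ q.

Lemma H1_data_ge0 p v mu K P : 0 < p -> H1_data p v mu K P ->
  [/\ 0 <= mu, 0 <= K & 0 <= P].
Proof.
move=> p0 [g [_ _ _ _ [<- <- PE]]]; split; [exact: sqnorm_ge0|exact: sqnorm_ge0|].
rewrite -lee_fin -PE Lnorm_powE//; apply: integral_ge0 => x _.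
by rewrite lee_fin powR_ge0.
Qed.

Lemma ground_level_ub p q v mu K P : H1_data p v mu K P ->
  (ground_level p q mu <= (energy_value p q K P `|v 0|)%:E)%E.
Proof.
move=> [g [cv Hv Hg vg [vmu gK PE]]]; apply: ereal_inf_lbound; exists v.
  by split; [exact: H1_intro vg|rewrite /= Lnorm_pow2// vmu].
rewrite /energy (Lnorm_pow_weak_derivative cv Hv Hg vg) PE gK.
by rewrite /energy_value EFinB EFinD !EFinM.
Qed.

(** A function with infinite L^p norm has energy +oo and satisfies any lower bound; this spares the
    embedding of H^1 into L^p. *)
Lemma ground_level_lb p q mu (x : \bar R) : 0 < p ->
  (forall v K P, H1_data p v mu K P ->
    (x <= (energy_value p q K P `|v 0|)%:E)%E) ->
  (x <= ground_level p q mu)%E.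
Proof.
move=> p0 H; apply/ereal_infP => _ [v [Hv vmu] <-].
have [cv Lv _] := Hv; have [Lg vg] := weak_derivativeP Hv.
have := Lnorm_pow_weak_derivative cv Lv Lg vg; rewrite /energy => ->.
have : (0 <= Lnorm_pow p v)%E by rewrite /Lnorm_pow poweR_ge0.
case E : (Lnorm_pow p v) => [P| |] // P0.
  rewrite (_ : (_ - _)%E = (energy_value p q (sqnorm (weak_derivative v)) P `|v 0|)%:E);
    last by rewrite /energy_value EFinB EFinD !EFinM.
  apply: H; exists (weak_derivative v).
  split => //; split => //.
  by apply: EFin_inj; rewrite -vmu Lnorm_pow2.
by rewrite gt0_muley ?lte_fin ?invr_gt0// addey// addye// leey.
Qed.

Lemma Lnorm_pow_integrable p v P : 0 < p -> L2 v -> Lnorm_pow p v = P%:E ->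
  leb.-integrable setT (EFin \o (fun x => `|v x| `^ p)) /\
  \int[leb]_x (`|v x| `^ p) = P.
Proof.
move=> p0 Hv; rewrite Lnorm_powE// => PE; split; last by rewrite /Rintegral PE.
apply/integrableP; split.
  apply/measurable_EFinP; apply: (measurableT_comp (measurable_powR _)) => //.
  by apply: measurableT_comp => //; exact: L2_measurable.
by under eq_integral do rewrite /= ger0_norm ?powR_ge0//; rewrite PE ltry.
Qed.

Lemma H1_data_trace4 p v mu K P nu : H1_data p v mu K P -> 0 < nu -> mu <= nu ->
  `|v 0| ^+ 4 <= nu * K.
Proof.
by move=> [g [cv Hv Hg vg [<- <- _]]] nu0; exact: trace_inequality4 vg _ nu0.
Qed.

Lemma H1_data_tracep p v mu K P : H1_data p v mu K P -> 2 < p ->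
  2 `^ (- p - 2) / p * `|v 0| `^ (p / 2 + 1) <= 2^-1 * K + p^-1 * P.
Proof.
move=> [g [cv Hv Hg vg [_ <- PE]]] p2.
have [|Ip <-] := @Lnorm_pow_integrable p _ _ _ Hv PE; first by lra.
by rewrite (mulrC 2^-1); exact: (trace_inequality_p cv).
Qed.

Lemma Lnorm_powZ c p v P : 0 < p -> 0 <= c -> L2 v -> Lnorm_pow p v = P%:E ->
  Lnorm_pow p (fun x => c * v x) = (c `^ p * P)%:E.
Proof.
move=> p0 c0 Hv PE; rewrite EFinM -PE !Lnorm_powE//.
rewrite -ge0_integralZl_EFin ?powR_ge0//.
- by apply: eq_integral => x _; rewrite normrM powRM// (ger0_norm c0) EFinM.
- by have [/integrableP[]] := Lnorm_pow_integrable p0 Hv PE.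
Qed.

Lemma H1_data_scale c p v mu K P : 0 < p -> 0 <= c -> H1_data p v mu K P ->
  H1_data p (fun x => c * v x) (c ^+ 2 * mu) (c ^+ 2 * K) (c `^ p * P).
Proof.
move=> p0 c0 [g [cv Hv Hg vg [<- <- PE]]]; exists (fun x => c * g x); split.
- by move=> x; apply: cvgM; [exact: cvg_cst|exact: cv].
- exact: L2Z.
- exact: L2Z.
- have := is_weak_derivativeD c L2_0 Hv L2_0 Hg is_weak_derivative0 vg.
  by under eq_fun do rewrite add0r; under [X in is_weak_derivative _ X]eq_fun do rewrite add0r.
- by rewrite !sqnormZ//; split => //; exact: Lnorm_powZ.
Qed.

Lemma H1_data0 p : 0 < p -> H1_data p (fun _ => 0) 0 0 0.
Proof.
move=> p0; exists (fun _ => 0); split.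
- by move=> x; exact: cvg_cst.
- exact: L2_0.
- exact: L2_0.
- exact: is_weak_derivative0.
- have S0 : @sqnorm R (fun=> 0) = 0.
    by rewrite /sqnorm expr0n/= Rintegral_cst// mul0r.
  split => //; rewrite Lnorm_powE//.
  by under eq_integral do rewrite normr0 powR0 ?gt_eqF//; rewrite integral0.
Qed.

Lemma H1_data_peak p A lam : 0 < p -> 0 <= A -> 0 < lam ->
  H1_data p (peak A lam) (A ^+ 2 / lam) (lam * A ^+ 2) (A `^ p * (2 / (p * lam))).
Proof.
move=> p0 A0 l0; exists (peak_slope A lam); split.
- exact: continuous_peak.
- exact: L2_peak.
- exact: L2_peak_slope.
- exact: weak_derivative_peak.
- by rewrite sqnorm_peak// sqnorm_peak_slope// Lnorm_pow_peak// ger0_norm.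
Qed.

Lemma peak0 A lam : peak A lam 0 = A.
Proof. by rewrite /peak normr0 mulr0 expR0 mulr1. Qed.

Lemma young_Rintegral (eta : R) f g : 0 < eta -> L2 f -> L2 g ->
  2 * `|\int[leb]_x (f x * g x)| <= eta * sqnorm f + sqnorm g / eta.
Proof.
move=> e0 Hf Hg; have If := L2_sqr Hf; have Ig := L2_sqr Hg; have Ifg := L2M Hf Hg.
have Ifg' := integrable_norm Ifg.
apply: (@le_trans _ _ (2 * \int[leb]_x `|f x * g x|)).
  by rewrite ler_pM2l//; apply: le_normr_Rintegral.
rewrite (mulrC _ eta^-1) /sqnorm -!RintegralZl//.
rewrite -RintegralD//; last 2 first.
- exact: integrable_scale.
- exact: integrable_scale.
apply: le_Rintegral => //.
- exact: integrable_scale.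
- by apply: integrable_add => //; exact: integrable_scale.
move=> x _; rewrite normrM -(real_normK (num_real (f x))) -(real_normK (num_real (g x))).
rewrite -(ler_pM2l e0) mulrDr (mulrA eta eta^-1) mulfV ?gt_eqF// mul1r.
by have := sqr_ge0 (eta * `|f x| - `|g x|); nra.
Qed.

Lemma Lnorm_of_pow p v P : 0 < p -> Lnorm_pow p v = P%:E ->
  Lnorm leb p%:E (EFin \o v) = (P `^ p^-1)%:E.
Proof.
move=> p0; rewrite /Lnorm_pow poweR_Lnorm ?gt_eqF// => PE.
by rewrite unlock PE poweR_EFin.
Qed.

(** The added peak has height d and rate d^2: mass 1, squared slope norm d^4, and L^p norm of order
    d^(1 - 2/p) with a positive exponent. All corrections vanish with d because the multiplier s
    stays below nu + 2. *)
Lemma H1_data_add_peak p v mu K P nu (d : R) : 2 < p ->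
  H1_data p v mu K P -> mu <= nu -> 0 < d ->
  exists u K' P', [/\ H1_data p u nu K' P',
    K' <= K + (nu + 2) * d ^+ 2 * (K + 1) + ((nu + 2) * d ^+ 2) ^+ 2,
    P' <= (P `^ p^-1 + (nu + 2) * ((2 / p) `^ p^-1 * d `^ (1 - 2 / p))) `^ p &
    `|v 0| - (nu + 2) * d <= `|u 0|].
Proof.
move=> p2 Hd munu d0; have p0 : 0 < p by lra.
have [mu0 K0 P0] := H1_data_ge0 p0 Hd.
have [g [cv Hv Hg vg [vmu gK PE]]] := Hd.
have d20 : 0 < d ^+ 2 by rewrite exprn_gt0.
pose w := peak d (d ^+ 2); pose h := peak_slope d (d ^+ 2).
have Hw : L2 w by exact: L2_peak.
have Hh : L2 h by exact: L2_peak_slope.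
have wh : is_weak_derivative w h by exact: weak_derivative_peak.
have w1 : sqnorm w = 1 by rewrite sqnorm_peak// divff ?gt_eqF.
have hd : sqnorm h = (d ^+ 2) ^+ 2 by rewrite sqnorm_peak_slope// expr2.
pose c := \int[leb]_x (v x * w x).
(* The nonnegative root of ||v + s w||^2 = nu. *)
pose s := - c + Num.sqrt (c ^+ 2 + (nu - mu)).
have c2 : 0 <= c ^+ 2 + (nu - mu) by rewrite addr_ge0 ?sqr_ge0// subr_ge0.
have s2 : s ^+ 2 + 2 * s * c = nu - mu.
  by have := sqr_sqrtr c2; rewrite /s; move: (Num.sqrt _) => z; nra.
have s0 : 0 <= s.
  rewrite /s addrC subr_ge0 (le_trans (ler_norm c))// -sqrtr_sqr ler_wsqrtr//.
  by rewrite lerDl subr_ge0.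
(* Young gives 2 |c| <= mu + 1; a root beyond nu + 2 would make s (s + 2 c) exceed nu - mu. *)
have sB : s <= nu + 2.
  have := young_Rintegral ltr01 Hv Hw; rewrite -/c vmu w1 invr1 mulr1 mul1r => cmu.
  have := ler_norm (- c); rewrite normrN => cn.
  rewrite leNgt; apply/negP => sB; nra.
pose u x := v x + s * w x.
have Hu : L2 u by apply: L2D => //; exact: L2Z.
have cw : continuous w by exact: continuous_peak.
have sw x : s * w x = peak (s * d) (d ^+ 2) x by rewrite /w /peak mulrA.
have PwE : Lnorm_pow p (fun x => s * w x) = ((s * d) `^ p * (2 / (p * d ^+ 2)))%:E.
  under eq_fun do rewrite sw.
  by rewrite Lnorm_pow_peak// ger0_norm// mulr_ge0// ltW.
have Nu : (Lnorm leb p%:E (EFin \o u) <=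
    (P `^ p^-1 + (nu + 2) * ((2 / p) `^ p^-1 * d `^ (1 - 2 / p)))%:E)%E.
  apply: (le_trans (minkowski_EFin leb _ _ _)).
  - exact: L2_measurable.
  - by have /L2_measurable := L2Z s Hw.
  - lra.
  rewrite (Lnorm_of_pow p0 PE) (Lnorm_of_pow p0 PwE) -EFinD lee_fin lerD2l.
  have sd : 0 <= s * d by rewrite mulr_ge0// ltW.
  rewrite powRM ?powR_ge0//; last by rewrite divr_ge0// mulr_ge0 ?ltW.
  rewrite -powRrM mulfV ?gt_eqF// powRr1//.
  have -> : (2 / (p * d ^+ 2)) `^ p^-1 = (2 / p) `^ p^-1 * d `^ (- (2 / p)).
    rewrite (_ : 2 / (p * _) = 2 / p * d `^ (- 2)); last first.
      by rewrite powRN powR_mulrn ?ltW//; field; rewrite !gt_eqF.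
    by rewrite powRM ?powR_ge0 ?divr_ge0 ?ltW// -powRrM mulNr.
  have -> : d `^ (1 - 2 / p) = d * d `^ (- (2 / p)).
    by rewrite powRD ?powRr1 ?ltW//; apply/implyP => _; rewrite gt_eqF.
  rewrite -mulrA (mulrCA d) ler_wpM2r//.
  by rewrite mulr_ge0 ?powR_ge0// mulr_ge0 ?powR_ge0// ltW.
pose N := fine (Lnorm leb p%:E (EFin \o u)).
have NE : Lnorm leb p%:E (EFin \o u) = N%:E.
  by rewrite /N fineK// ge0_fin_numE ?Lnorm_ge0// (le_lt_trans Nu)// ltry.
have N0 : 0 <= N by rewrite fine_ge0// Lnorm_ge0.
exists u, (sqnorm (fun x => g x + s * h x)), (N `^ p); split.
- exists (fun x => g x + s * h x); split.
  + by move=> x; apply: cvgD; [exact: cv|apply: cvgM; [exact: cvg_cst|exact: cw]].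
  + exact: Hu.
  + by apply: L2D => //; exact: L2Z.
  + exact: is_weak_derivativeD.
  + split => //; last by rewrite /Lnorm_pow NE poweR_EFin.
    by rewrite sqnormDZ// -/c vmu w1 mulr1 -addrA (addrC (2 * s * c)) s2 addrC subrK.
- rewrite sqnormDZ// gK hd.
  (* The weight d^2 splits the cross term into d^2 K and d^4 / d^2, both small with d. *)
  have := young_Rintegral d20 Hg Hh; rewrite gK hd (expr2 (d ^+ 2)) mulfK ?gt_eqF//.
  move: (\int[_]_x _) => J HJ; have := ler_norm J => J1.
  have H1 : 2 * s * J <= (nu + 2) * (d ^+ 2 * K + d ^+ 2).
    apply: (@le_trans _ _ (s * (2 * `|J|))); first by nra.
    by apply: ler_pM.
  have H2 : s ^+ 2 <= (nu + 2) ^+ 2 by rewrite ler_sqr ?nnegrE//; lra.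
  have H3 := ler_wpM2r (sqr_ge0 (d ^+ 2)) H2.
  by rewrite exprMn; nra.
- move: Nu; rewrite NE lee_fin => Nu.
  by rewrite ge0_ler_powR ?nnegrE ?(ltW p0)// (le_trans N0 Nu).
- have u0 : u 0 = v 0 + s * d by rewrite /u /w peak0.
  rewrite u0; have := ler_normB (v 0 + s * d) (s * d); rewrite addrK.
  rewrite (ger0_norm (mulr_ge0 s0 (ltW d0))).
  have := ler_wpM2r (ltW d0) sB; lra.
Qed.

End GroundLevelBounds.

(** * Real powers: continuity and comparison of exponents *)

Section PowerFunctions.
Context {R : realType}.
Implicit Types (a b c r q t C M : R).

(** The truncation gives a function continuous on the whole line, so that limits at 0 can be taken
    without restricting the domain. *)
Lemma continuous_powR_max r : 0 < r -> continuous (fun x : R => Num.max x 0 `^ r).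
Proof.
move=> r0 x; have [x0|x0|->] := ltgtP x 0.
- rewrite /continuous_at max_r ?(ltW x0)//; apply: (@cvg_near_cst _ _ (0 `^ r)).
  by near=> y; rewrite max_r// ltW//; near: y; exact: lt_nbhsl.
- rewrite /continuous_at max_l ?(ltW x0)//.
  have cx : {for x, continuous (@powR R ^~ r)}.
    apply: differentiable_continuous; apply/derivable1_diffP.
    by apply: derivable_powR; rewrite in_itv/= x0.
  apply: cvg_trans cx; apply: near_eq_cvg; near=> y.
  by rewrite max_l// ltW//; near: y; exact: lt_nbhsr.
- rewrite /continuous_at maxxx powR0 ?gt_eqF//; apply/cvgrPdist_le => e e0.
  near=> y; rewrite sub0r normrN ger0_norm ?powR_ge0//.
  have -> : e = (e `^ r^-1) `^ r by rewrite -powRrM mulVf ?gt_eqF// powRr1 ?ltW.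
  rewrite ge0_ler_powR ?nnegrE ?powR_ge0 ?(ltW r0)//; first by rewrite le_max lexx orbT.
  rewrite ge_max powR_ge0 andbT (le_trans (ler_norm y))//.
  by near: y; apply: (@nbhs0_le R R^o); exact: powR_gt0.
Unshelve. all: by end_near. Qed.

Lemma powR_splitB a q r : a != 0 -> a `^ r = a `^ q * a `^ (r - q).
Proof.
by move=> a0; rewrite -powRD ?a0 ?implybT//; congr (_ `^ _); ring.
Qed.

(** Factor A^q as A^r A^(q - r) and make the second factor at least (C + |M|) / c. The free bound
    [A0] lets a further largeness condition be imposed. *)
Lemma powR_dominates r q c C M A0 : 0 <= r -> r < q -> 0 < c -> 0 <= C ->
  exists A : R, [/\ 1 <= A, A0 <= A & C * A `^ r - c * A `^ q <= - M].
Proof.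
move=> r0 rq c0 C0.
pose z := ((C + `|M|) / c) `^ (q - r)^-1; exists (Num.max (Num.max 1 A0) z).
set A := Num.max _ _.
have A1 : 1 <= A by rewrite /A !le_max lexx.
have AA0 : A0 <= A by rewrite /A !le_max lexx orbT.
have Az : z <= A by rewrite /A le_max lexx orbT.
split => //; have qr : 0 < q - r by rewrite subr_gt0.
have H : (C + `|M|) / c <= A `^ (q - r).
  have -> : (C + `|M|) / c = z `^ (q - r).
    by rewrite /z -powRrM mulVf ?gt_eqF// powRr1// divr_ge0 ?(ltW c0)// addr_ge0.
  rewrite ge0_ler_powR ?nnegrE ?powR_ge0 ?(ltW qr)//.
  by rewrite (le_trans ler01 A1).
have -> : A `^ q = A `^ r * A `^ (q - r).
  by apply: powR_splitB; rewrite gt_eqF// (lt_le_trans ltr01).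
have Ar : 1 <= A `^ r by have := ler_powR A1 r0; rewrite powRr0.
move: H; rewrite ler_pdivrMr// => H.
have := ler_norm M; have := normr_ge0 M; nra.
Qed.

(** Beyond some A the larger power wins, since t^(r - q) increases; below A the constant A^q
    suffices. *)
Lemma powR_absorb q r c : 0 < q -> q < r -> 0 < c ->
  exists2 C, 0 <= C & forall t, 0 <= t -> t `^ q <= c * t `^ r + C.
Proof.
move=> q0 qr c0.
have [A [A1 _ HA]] := @powR_dominates q r c 1 0 0 (ltW q0) qr c0 ler01.
exists (A `^ q); first exact: powR_ge0.
move=> t t0; have [tA|At] := leP t A.
  rewrite (@le_trans _ _ (A `^ q))// ?ge0_ler_powR ?nnegrE ?(ltW q0)//.
    exact: le_trans tA.
  by rewrite lerDr mulr_ge0 ?powR_ge0// ltW.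
have A0 : 0 < A by exact: lt_le_trans A1.
have t0' : 0 < t by exact: lt_trans At.
apply: (@le_trans _ _ (c * t `^ r)); last by rewrite lerDl powR_ge0.
have ge0A := ltW A0.
rewrite (powR_splitB q r (lt0r_neq0 t0')) mulrCA ler_peMr ?powR_ge0//.
apply: (@le_trans _ _ (c * A `^ (r - q))).
  move: HA; rewrite mul1r oppr0 subr_le0 (powR_splitB q r (lt0r_neq0 A0)).
  by rewrite mulrCA ler_pMr ?powR_gt0.
by rewrite ler_pM2l// ge0_ler_powR ?nnegrE ?subr_ge0 ?(ltW qr)//; exact: ltW.
Qed.

End PowerFunctions.

(** * Monotonicity, coercivity and the values -oo and 0 *)

Section GroundLevel.
Context {R : realType}.
Implicit Types (A lam x y r p q K P t mu nu e : R) (v : R -> R).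
Local Open Scope ring_scope.

(** The energy after adding a peak of height d is at most [f d], with [f] continuous and [f 0] the
    energy of v; then d tends to 0. Explicit competitors need only have mass at most nu. *)
Lemma ground_level_le_energy p q v mu K P nu : 2 < p -> 0 < q ->
  H1_data p v mu K P -> mu <= nu ->
  (ground_level p q nu <= (energy_value p q K P `|v 0|)%:E)%E.
Proof.
move=> p2 q0 Hd munu; have p0 : 0 < p by lra.
have [mu0 K0 P0] := H1_data_ge0 p0 Hd.
set t := `|v 0|; have t0 : 0 <= t by exact: normr_ge0.
pose B := nu + 2; have B0 : 0 <= B by rewrite /B; lra.
pose D := (2 / p) `^ p^-1; have D0 : 0 <= D by exact: powR_ge0.
have r0 : 0 < 1 - 2 / p by rewrite subr_gt0 ltr_pdivrMr// mul1r.
pose f1 d := K + B * d ^+ 2 * (K + 1) + (B * d ^+ 2) ^+ 2.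
pose f2 (d : R) := P `^ p^-1 + B * (D * Num.max d 0 `^ (1 - 2 / p)).
pose f d := 2^-1 * f1 d + p^-1 * Num.max (f2 d) 0 `^ p - q^-1 * Num.max (t - B * d) 0 `^ q.
have cid : continuous (fun d : R => d) by move=> x; exact: cvg_id.
have cc (c : R) : continuous (fun _ : R => c) by move=> x; exact: cvg_cst.
have cM (h1 h2 : R -> R) : continuous h1 -> continuous h2 ->
    continuous (fun x => h1 x * h2 x).
  by move=> H1 H2 x; apply: cvgM; [exact: H1|exact: H2].
have cD (h1 h2 : R -> R) : continuous h1 -> continuous h2 ->
    continuous (fun x => h1 x + h2 x).
  by move=> H1 H2 x; apply: cvgD; [exact: H1|exact: H2].
have cN (h1 : R -> R) : continuous h1 -> continuous (fun x => - h1 x).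
  by move=> H1 x; apply: cvgN; exact: H1.
have cP (r : R) (h1 : R -> R) : 0 < r -> continuous h1 ->
    continuous (fun x => Num.max (h1 x) 0 `^ r).
  move=> r0' H1 x; apply: (@continuous_comp _ _ _ h1 (fun y => Num.max y 0 `^ r)).
    exact: H1.
  exact: continuous_powR_max.
have cf : continuous f.
  have cB : continuous (fun d : R => B * d ^+ 2) by apply: (cM) => //; exact: (cM).
  apply: (cD); last by apply: (cN); apply: (cM) => //; apply: (cP) => //;
    apply: (cD) => //; apply: (cN); exact: (cM).
  apply: (cD); apply: (cM) => //.
    by apply: (cD); [apply: (cD) => //; exact: (cM)|exact: (cM)].
  by apply: (cP) => //; apply: (cD) => //; apply: (cM) => //; apply: (cM) => //; exact: (cP).
have f0 : f 0 = energy_value p q K P t.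
  rewrite /f /f1 /f2 /energy_value maxxx powR0 ?gt_eqF// !mulr0 subr0 !addr0.
  rewrite expr2 !mulr0 mul0r !addr0 expr2 mul0r addr0 !max_l ?powR_ge0//.
  by rewrite -powRrM mulVf ?gt_eqF// powRr1.
rewrite -f0; apply/lee_addgt0Pr => e e0.
have /cvgrPdist_le/(_ _ e0) := cf 0; move=> [d /= d0 dP].
have d20 : 0 < d / 2 by rewrite divr_gt0.
have : `|f 0 - f (d / 2)| <= e.
  by apply: dP; rewrite /= sub0r normrN gtr0_norm// ltr_pdivrMr//; lra.
rewrite ler_norml => /andP[fe _].
have [u [K' [P' [Hu HK HP Hu0]]]] := H1_data_add_peak p2 Hd munu d20.
apply: (le_trans (ground_level_ub q Hu)); rewrite -EFinD lee_fin.
apply: (@le_trans _ _ (f (d / 2))); last by lra.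
have [_ _ P'0] := H1_data_ge0 p0 Hu.
rewrite /energy_value /f lerD ?lerN2//.
  rewrite lerD// ler_pM2l ?invr_gt0//.
  rewrite /f2 max_l; last by rewrite addr_ge0 ?powR_ge0 ?mulr_ge0 ?powR_ge0.
  by rewrite (max_l (ltW d20)).
rewrite ler_pM2l ?invr_gt0// ge0_ler_powR ?nnegrE ?(ltW q0)//.
  by rewrite le_max lexx orbT.
by rewrite ge_max normr_ge0 andbT.
Qed.

Lemma ground_level_nonincreasing p q mu nu : 2 < p -> 0 < q -> mu <= nu ->
  (ground_level p q nu <= ground_level p q mu)%E.
Proof.
move=> p2 q0 munu; apply: ground_level_lb => [|v K P Hd]; first by lra.
exact: ground_level_le_energy Hd munu.
Qed.

(** The zero function, of mass 0, serves as competitor. *)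
Lemma ground_level_le0 p q mu : 2 < p -> 0 < q -> 0 <= mu ->
  (ground_level p q mu <= 0)%E.
Proof.
move=> p2 q0 mu0; have p0 : 0 < p by lra.
have := ground_level_le_energy p2 q0 (H1_data0 p0) mu0.
by rewrite /energy_value normr0 powR0 ?gt_eqF// !mulr0 addr0 subr0.
Qed.

Lemma ground_level_le_peak p q A lam mu : 2 < p -> 0 < q -> 0 <= A -> 0 < lam ->
  A ^+ 2 / lam <= mu ->
  (ground_level p q mu <=
   (2^-1 * (lam * A ^+ 2) + 2 / p ^+ 2 * (A `^ p / lam) - q^-1 * A `^ q)%:E)%E.
Proof.
move=> p2 q0 A0 l0 Amu; have p0 : 0 < p by lra.
have := ground_level_le_energy p2 q0 (H1_data_peak p0 A0 l0) Amu.
rewrite /energy_value peak0 ger0_norm// => /le_trans; apply.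
rewrite lee_fin le_eqVlt; apply/orP; left; apply/eqP; congr (_ + _ - _).
by field; rewrite !gt_eqF.
Qed.

Lemma ereal_eqNy (z : \bar R) : (forall M : R, (z <= (- M)%:E)%E) -> z = -oo%E.
Proof.
case: z => [z| |] // H; last by have := H 0.
by have := H (1 - z); rewrite lee_fin => ?; exfalso; lra.
Qed.

(** The exponent s of the rate must exceed 2 for the mass to vanish, exceed p - q and stay below q -
    2 for the trace term to dominate. The hypothesis on q says that this window is nonempty; s is
    its midpoint. *)
Lemma ground_level_supercritical p q mu : 2 < p -> Num.max 4 (p / 2 + 1) < q ->
  0 < mu -> ground_level p q mu = -oo%E.
Proof.
move=> p2; rewrite gt_max => /andP[q4 qp] mu0; apply: ereal_eqNy => M.
have p0 : 0 < p by lra.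
pose m := Num.max 2 (p - q).
have mq : m < q - 2 by rewrite /m gt_max; apply/andP; split; lra.
(* With lam = A^s, the kinetic, L^p and trace terms and the mass are of order
   A^(2+s), A^(p-s), A^q and A^(2-s). *)
pose s := (m + (q - 2)) / 2.
have s2 : 2 < s.
  have : 2 <= m by rewrite /m le_max lexx.
  by rewrite /s; lra.
have spq : p - q < s.
  have : p - q <= m by rewrite /m le_max lexx orbT.
  by rewrite /s; lra.
have sq : s < q - 2 by rewrite /s; lra.
pose r := Num.max (2 + s) (p - s).
have rq : r < q by rewrite /r gt_max; apply/andP; split; lra.
have r1 : 2 + s <= r by rewrite /r le_max lexx.
have r2 : p - s <= r by rewrite /r le_max lexx orbT.
have C0 : 0 <= 2^-1 + 2 / p ^+ 2 by rewrite addr_ge0// divr_ge0 ?sqr_ge0.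
(* The lower bound imposed on A is what makes the mass A^(2 - s) at most mu. *)
have [A [A1 AA0 HA]] := @powR_dominates R r q q^-1 (2^-1 + 2 / p ^+ 2) M
  (mu^-1 `^ (s - 2)^-1) ltac:(lra) rq ltac:(by rewrite invr_gt0; lra) C0.
have A0 : 0 < A by exact: lt_le_trans A1.
have As0 : 0 < A `^ s by rewrite powR_gt0.
have An0 : A != 0 by rewrite gt_eqF.
have Amu : A ^+ 2 / A `^ s <= mu.
  rewrite ler_pdivrMr// (_ : A `^ s = A `^ (s - 2) * A ^+ 2); last first.
    by rewrite -powR_mulrn ?(ltW A0)// -powRD ?subrK// An0 implybT.
  rewrite mulrA ler_peMl ?sqr_ge0// -ler_pdivrMl// mulr1.
  have -> : mu^-1 = (mu^-1 `^ (s - 2)^-1) `^ (s - 2).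
    by rewrite -powRrM mulVf ?powRr1 ?invr_ge0 ?(ltW mu0)// gt_eqF// subr_gt0.
  by rewrite ge0_ler_powR ?nnegrE ?powR_ge0 ?(ltW A0)// subr_ge0 ltW.
apply: le_trans (ground_level_le_peak p2 _ (ltW A0) As0 Amu) _; first by lra.
rewrite lee_fin; apply: le_trans HA; rewrite lerD2r [leRHS]mulrDl; apply: lerD.
  rewrite ler_pM2l// -powR_mulrn ?(ltW A0)// -powRD ?An0 ?implybT//.
  by rewrite addrC ler_powR.
rewrite ler_pM2l ?divr_gt0 ?exprn_gt0// -powRB ?An0 ?implybT//.
by rewrite ler_powR.
Qed.

(** At rate A^2 / mu the mass is exactly mu, and A^4 has coefficient 1/(2 mu) - 1/4, negative for mu
    > 2. The L^p term is of order A^(p - 2), lower since p < 6. *)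
Lemma ground_level_critical_Ny p mu : 2 < p < 6 -> 2 < mu ->
  ground_level p 4 mu = -oo%E.
Proof.
move=> /andP[p2 p6] mu2; apply: ereal_eqNy => M.
have p0 : 0 < p by lra.
have mu0 : 0 < mu by lra.
have c0 : 0 < 4^-1 - (2 * mu)^-1.
  by rewrite subr_gt0 ltf_pV2 ?posrE ?mulr_gt0//; lra.
have C0 : 0 <= 2 / p ^+ 2 * mu by rewrite mulr_ge0 ?divr_ge0 ?sqr_ge0// ltW.
have [A [A1 _ HA]] := @powR_dominates R (p - 2) 4 _ _ M 0 ltac:(lra) ltac:(lra) c0 C0.
have A0 : 0 < A by exact: lt_le_trans A1.
have An0 : A != 0 by rewrite gt_eqF.
have l0 : 0 < A ^+ 2 / mu by rewrite divr_gt0// exprn_gt0.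
have Amu : A ^+ 2 / (A ^+ 2 / mu) <= mu.
  by rewrite le_eqVlt; apply/orP; left; apply/eqP; field; rewrite An0 gt_eqF.
apply: le_trans (ground_level_le_peak p2 _ (ltW A0) l0 Amu) _; first by lra.
rewrite lee_fin; apply: le_trans HA; rewrite le_eqVlt; apply/orP; left; apply/eqP.
rewrite powRB ?An0 ?implybT// !powR_mulrn ?(ltW A0)//.
by field; rewrite An0 !gt_eqF.
Qed.

Lemma ground_level_critical0 p mu : 2 < p -> 0 <= mu <= 2 ->
  ground_level p 4 mu = 0%E.
Proof.
move=> p2 /andP[mu0 mu2]; have p0 : 0 < p by lra.
apply/le_anti; rewrite ground_level_le0//=.
apply: ground_level_lb => // v K P Hd; have [_ K0 P0] := H1_data_ge0 p0 Hd.
have := H1_data_trace4 Hd (ltr0n R 2) mu2.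
rewrite lee_fin /energy_value powR_mulrn//.
have : 0 <= p^-1 * P by rewrite mulr_ge0// invr_ge0 ltW.
lra.
Qed.

(** The trace power is absorbed by whichever trace inequality has the larger exponent than q. The
    factor 1/2 leaves half of the positive terms to control K, and C is uniform over masses up to
    nu. *)
Lemma trace_coercive p q nu : 2 < p -> 0 < q -> q < Num.max 4 (p / 2 + 1) ->
  0 < nu -> exists2 C, 0 <= C & forall v mu K P, H1_data p v mu K P -> mu <= nu ->
    q^-1 * `|v 0| `^ q <= 2^-1 * (2^-1 * K + p^-1 * P) + C.
Proof.
move=> p2 q0; rewrite lt_max => qmax nu0; have p0 : 0 < p by lra.
case/orP: qmax => qmax.
  (* After division by q this becomes |v 0|^4 / (4 nu), at most K / 4. *)
  have c0 : 0 < q / (4 * nu) by rewrite divr_gt0// mulr_gt0.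
  have [C C0 HC] := powR_absorb q0 qmax c0.
  exists (q^-1 * C); first by rewrite mulr_ge0// invr_ge0 ltW.
  move=> v mu K P Hd munu; have [_ K0 P0] := H1_data_ge0 p0 Hd.
  have := HC `|v 0| (normr_ge0 _).
  rewrite -(ler_pM2l (_ : 0 < q^-1)) ?invr_gt0// => /le_trans; apply.
  rewrite mulrDr lerD2r powR_mulrn//.
  have := H1_data_trace4 Hd nu0 munu.
  have -> : q^-1 * (q / (4 * nu) * `|v 0| ^+ 4) = `|v 0| ^+ 4 / nu / 4.
    by field; rewrite !gt_eqF.
  rewrite mulrC -ler_pdivrMr// => H4.
  have : 0 <= p^-1 * P by rewrite mulr_ge0// invr_ge0 ltW.
  lra.
set c1 := 2 `^ (- p - 2) / p.
have c10 : 0 < c1 by rewrite divr_gt0 ?powR_gt0.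
have c0 : 0 < q * c1 / 2 by rewrite divr_gt0// mulr_gt0.
have [C C0 HC] := powR_absorb q0 qmax c0.
exists (q^-1 * C); first by rewrite mulr_ge0// invr_ge0 ltW.
move=> v mu K P Hd munu.
have := HC `|v 0| (normr_ge0 _).
rewrite -(ler_pM2l (_ : 0 < q^-1)) ?invr_gt0// => /le_trans; apply.
rewrite mulrDr lerD2r.
have := H1_data_tracep Hd p2; rewrite -/c1.
have -> : q^-1 * (q * c1 / 2 * `|v 0| `^ (p / 2 + 1)) = 2^-1 * (c1 * `|v 0| `^ (p / 2 + 1)).
  by field; rewrite gt_eqF.
by rewrite ler_pM2l.
Qed.

Lemma ground_level_gtNy p q mu : 2 < p -> 0 < q -> q < Num.max 4 (p / 2 + 1) ->
  (-oo < ground_level p q mu)%E.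
Proof.
move=> p2 q0 qmax; have p0 : 0 < p by lra.
have [C C0 HC] := trace_coercive p2 q0 qmax (ltr_wpDl (normr_ge0 mu) ltr01).
apply: (@lt_le_trans _ _ (- C)%:E); first exact: ltNyr.
apply: ground_level_lb => // v K P Hd; have [_ K0 P0] := H1_data_ge0 p0 Hd.
have /(HC _ _ _ _ Hd) H : mu <= `|mu| + 1 by rewrite (le_trans (ler_norm mu))// lerDl.
rewrite lee_fin /energy_value.
have : 0 <= p^-1 * P by rewrite mulr_ge0// invr_ge0 ltW.
lra.
Qed.

End GroundLevel.

(** * Continuity *)

Section Continuity.
Context {R : realType}.
Implicit Types (x y r p q K P t mu nu e c : R) (v : R -> R).

Lemma ground_level_approx p q mu a e : 0 < p -> ground_level p q mu = a%:E ->
  0 < e -> exists v K P, H1_data p v mu K P /\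
    energy_value p q K P `|v 0| <= a + e.
Proof.
move=> p0 glE e0; apply: contrapT => H.
have : ((a + e)%:E <= ground_level p q mu)%E.
  apply: ground_level_lb => // v K P Hd; rewrite lee_fin leNgt.
  by apply/negP => /ltW E; apply: H; exists v, K, P.
by rewrite glE lee_fin; lra.
Qed.

Lemma ground_level_scale p q v mu K P c : 0 < p -> 0 < q ->
  H1_data p v mu K P -> 0 <= c <= 1 ->
  (ground_level p q (c ^+ 2 * mu) <=
   (energy_value p q K P `|v 0| + (1 - c `^ q) * (q^-1 * `|v 0| `^ q))%:E)%E.
Proof.
move=> p0 q0 Hd /andP[c0 c1]; have [mu0 K0 P0] := H1_data_ge0 p0 Hd.
apply: le_trans (ground_level_ub q (H1_data_scale p0 c0 Hd)) _.
rewrite lee_fin /energy_value normrM (ger0_norm c0) powRM//.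
have cp : c `^ p * P <= P.
  rewrite ler_piMl//; have := @ge0_ler_powR R p (ltW p0) c 1.
  by rewrite powR1 !nnegrE; apply.
have cK : c ^+ 2 * K <= K by rewrite ler_piMl// expr_le1.
have p1 : 0 <= p^-1 by rewrite invr_ge0 ltW.
have := ler_wpM2l p1 cp.
move: (c `^ q) (_ `^ q) (q^-1) => X Y Z; nra.
Qed.

(** From x - 1 = (sqrt x - 1) (sqrt x + 1), whose last factor is at least 1. *)
Lemma sqrt_dist1 x : 0 <= x -> `|Num.sqrt x - 1| <= `|x - 1|.
Proof.
move=> x0; have s0 := sqrtr_ge0 x.
rewrite -{2}(sqr_sqrtr x0) -{2}(expr1n R 2) subr_sqr normrM ler_peMr//.
by rewrite ger0_norm ?addr_ge0// lerDr.
Qed.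

(** Here x is a ratio of masses and T a bound on the trace term; h depends on the function only
    through T. *)
Lemma scaling_factor_near1 q e (T : R) : 0 < q -> 0 < e -> 0 <= T ->
  exists2 h : R, 0 < h & forall x, 0 <= x <= 1 -> `|x - 1| < h ->
    (1 - Num.sqrt x `^ q) * T <= e.
Proof.
move=> q0 e0 T0; have eT : 0 < e / (T + 1) by rewrite divr_gt0// ltr_wpDl.
have /cvgrPdist_le/(_ _ eT) := @continuous_powR_max R q q0 1.
move=> [h /= h0 hP]; exists h => // x /andP[x0 x1] xh.
have := hP (Num.sqrt x); rewrite /= distrC (le_lt_trans (sqrt_dist1 x0))// => /(_ isT).
rewrite !max_l ?sqrtr_ge0// powR1 ler_norml => /andP[_ H].
apply: (@le_trans _ _ (e / (T + 1) * T)); first by rewrite ler_wpM2r.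
by rewrite mulrAC ler_pdivrMr ?ltr_wpDl// ler_pM2l// lerDl.
Qed.

(** * Continuity of the level in the subcritical range *)

Section Subcritical.
Variables (p q : R).
Hypotheses (p2 : 2 < p) (q0 : 0 < q) (qmax : q < Num.max 4 (p / 2 + 1)).

Let p0 : 0 < p. Proof. by apply: lt_trans p2. Qed.

Definition level mu := fine (ground_level p q mu).

Lemma levelE mu : 0 <= mu -> ground_level p q mu = (level mu)%:E.
Proof.
move=> mu0; rewrite /level fineK// fin_real// ground_level_gtNy//=.
exact: le_lt_trans (ground_level_le0 p2 q0 mu0) (ltry 0).
Qed.

Lemma level_nonincreasing x y : 0 <= x -> x <= y -> level y <= level x.
Proof.
move=> x0 xy; rewrite -lee_fin -!levelE//; last exact: le_trans xy.
exact: ground_level_nonincreasing.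
Qed.

Lemma level_le0 x : 0 <= x -> level x <= 0.
Proof. by move=> x0; rewrite -lee_fin -levelE//; exact: ground_level_le0. Qed.

(** A single near-minimizer at x is scaled down to every nearby y, so h may depend on it. *)
Lemma level_left x e : 0 <= x -> 0 < e -> exists2 h : R, 0 < h &
  forall y, 0 <= y <= x -> `|y - x| < h -> level y <= level x + e.
Proof.
move=> x0 e0.
have [->|xn0] := eqVneq x 0.
  exists 1 => // y; rewrite -eq_le eq_sym => /eqP -> _; lra.
have {xn0 x0} x0 : 0 < x by rewrite lt_neqAle eq_sym xn0.
have e20 : 0 < e / 2 by rewrite divr_gt0.
have [v [K [P [Hd HE]]]] := ground_level_approx p0 (levelE (ltW x0)) e20.
have T0 : 0 <= q^-1 * `|v 0| `^ q by rewrite mulr_ge0 ?powR_ge0// invr_ge0 ltW.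
have [h h0 hP] := scaling_factor_near1 q0 e20 T0.
exists (h * x); first by rewrite mulr_gt0.
move=> y /andP[y0 yx] yxh.
have yx0 : 0 <= y / x by rewrite divr_ge0// ltW.
have yx1 : y / x <= 1 by rewrite ler_pdivrMr// mul1r.
have := hP (y / x); rewrite yx0 yx1 => /(_ isT) H.
have {}H : (1 - Num.sqrt (y / x) `^ q) * (q^-1 * `|v 0| `^ q) <= e / 2.
  apply: H; rewrite (_ : y / x - 1 = (y - x) / x); last by field; rewrite gt_eqF.
  by rewrite normrM normfV (gtr0_norm x0) ltr_pdivrMr.
have c1 : 0 <= Num.sqrt (y / x) <= 1.
  by rewrite sqrtr_ge0 -sqrtr1 ler_sqrt.
have := ground_level_scale p0 q0 Hd c1; rewrite sqr_sqrtr// divfK ?gt_eqF//.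
by rewrite levelE// lee_fin; lra.
Qed.

(** The near-minimizer now changes with y, and only the uniform bound on its trace yields a common
    h. At x = 0 scaling down to mass 0 has factor 0, so the trace term is shown to be small
    instead. *)
Lemma level_right x e : 0 <= x -> 0 < e -> exists2 h : R, 0 < h &
  forall y, x <= y -> `|y - x| < h -> level x <= level y + e.
Proof.
move=> x0 e0.
have [C C0 HC] := trace_coercive p2 q0 qmax (ltr_wpDl x0 ltr01).
pose e1 := Num.min (e / 2) 1.
have e10 : 0 < e1 by rewrite lt_min divr_gt0/=.
have e1e : e1 <= e / 2 by rewrite ge_min lexx.
have e11 : e1 <= 1 by rewrite ge_min lexx orbT.
have e20 : 0 < e / 2 by rewrite divr_gt0.
(* The level is non-positive and e1 <= 1, so the energy is at most 1; coercivity then bounds the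
   positive terms by 2 + 2 C and the trace term by 1 + 2 C. *)
have near_min y : x <= y -> `|y - x| < 1 -> exists v K P,
    [/\ H1_data p v y K P, energy_value p q K P `|v 0| <= level y + e1,
        K <= 4 + 4 * C & q^-1 * `|v 0| `^ q <= 1 + 2 * C].
  move=> xy yx1; have y0 : 0 <= y by exact: le_trans xy.
  have [v [K [P [Hd HE]]]] := ground_level_approx p0 (levelE y0) e10.
  exists v, K, P; have [_ K0 P0] := H1_data_ge0 p0 Hd.
  have yx : y <= x + 1 by move: yx1; rewrite ltr_norml; lra.
  have H := HC _ _ _ _ Hd yx.
  have Pp : 0 <= p^-1 * P by rewrite mulr_ge0// invr_ge0 ltW.
  have ly := level_le0 y0.
  by move: (HE); rewrite /energy_value => HE'; split => //; lra.
have T0 : 0 <= 1 + 2 * C by lra.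
have [x00|xn0] := eqVneq x 0; last first.
  have {xn0} x0' : 0 < x by rewrite lt_neqAle eq_sym xn0.
  have [h h0 hP] := scaling_factor_near1 q0 e20 T0.
  exists (Num.min 1 (h * x)); first by rewrite lt_min ltr01 mulr_gt0.
  move=> y xy; rewrite lt_min => /andP[y1 yh].
  have [v [K [P [Hd HE HK HT]]]] := near_min y xy y1.
  have y0 : 0 < y by exact: lt_le_trans xy.
  have xy0 : 0 <= x / y by rewrite divr_ge0// ltW.
  have xy1 : x / y <= 1 by rewrite ler_pdivrMr// mul1r.
  have c1 : 0 <= Num.sqrt (x / y) <= 1.
    by rewrite sqrtr_ge0 -sqrtr1 ler_sqrt.
  have := hP (x / y); rewrite xy0 xy1 => /(_ isT) H.
  have {}H : (1 - Num.sqrt (x / y) `^ q) * (1 + 2 * C) <= e / 2.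
    apply: H; rewrite (_ : x / y - 1 = (x - y) / y); last by field; rewrite gt_eqF.
    rewrite normrM normfV (gtr0_norm y0) ltr_pdivrMr// distrC.
    by rewrite (lt_le_trans yh)// ler_pM2l.
  have := ground_level_scale p0 q0 Hd c1; rewrite sqr_sqrtr// divfK ?gt_eqF//.
  rewrite levelE// lee_fin.
  have q1 : 0 <= 1 - Num.sqrt (x / y) `^ q.
    rewrite subr_ge0; case/andP: c1 => c0 c1.
    by have := @ge0_ler_powR R q (ltW q0) _ 1 _ _ c1; rewrite powR1 !nnegrE; apply.
  have := ler_wpM2l q1 HT; lra.
pose K0 := 4 + 4 * C; have K00 : 0 < K0 by rewrite /K0; lra.
have qe0 : 0 < q * (e / 2) by rewrite mulr_gt0.
(* Chosen so that |v 0|^4 <= h K0 is exactly the statement that the trace term is at most e / 2. *)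
pose h := (q * (e / 2)) `^ (4 / q) / K0.
have h0 : 0 < h by rewrite divr_gt0// powR_gt0.
exists (Num.min 1 h); first by rewrite lt_min ltr01.
move=> y xy; rewrite lt_min => /andP[y1 yh].
have [v [K [P [Hd HE HK HT]]]] := near_min y xy y1.
apply: le_trans (level_le0 x0) _.
have [_ Kge0 P0] := H1_data_ge0 p0 Hd.
have Pp : 0 <= p^-1 * P by rewrite mulr_ge0// invr_ge0 ltW.
suff : q^-1 * `|v 0| `^ q <= e / 2 by move: HE; rewrite /energy_value; lra.
rewrite mulrC ler_pdivrMr// (mulrC _ q).
move: xy y1 yh; rewrite x00 subr0 => y0 _; rewrite ger0_norm// => yh.
have h00 : 0 < y + h by rewrite ltr_wpDl.
have t4 : `|v 0| `^ 4 <= (q * (e / 2)) `^ (4 / q).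
  rewrite powR_mulrn//; have [y00|yn0] := eqVneq y 0.
    have := H1_data_trace4 Hd h0; rewrite {1}y00 (ltW h0) => /(_ isT).
    move=> /le_trans; apply; rewrite /h mulrAC ler_pdivrMr// ler_pM2l ?powR_gt0//.
  have y0' : 0 < y by rewrite lt_neqAle eq_sym yn0.
  apply: le_trans (H1_data_trace4 Hd y0' (lexx y)) _.
  apply: (@le_trans _ _ (h * K0)); first by rewrite ler_pM// ltW.
  by rewrite /h divfK// gt_eqF.
have -> : `|v 0| `^ q = (`|v 0| `^ 4) `^ (q / 4).
  by rewrite -powRrM; congr (_ `^ _); field.
have -> : q * (e / 2) = ((q * (e / 2)) `^ (4 / q)) `^ (q / 4).
  rewrite -powRrM (_ : 4 / q * (q / 4) = 1); last by field; rewrite gt_eqF.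
  by rewrite powRr1 ?ltW.
by rewrite ge0_ler_powR ?nnegrE ?powR_ge0// divr_ge0// ltW.
Qed.

Lemma level_continuous x e : 0 <= x -> 0 < e -> exists2 h : R, 0 < h &
  forall y, 0 <= y -> `|y - x| < h -> `|level x - level y| <= e.
Proof.
move=> x0 e0; have [h1 h10 H1] := level_left x0 e0.
have [h2 h20 H2] := level_right x0 e0.
exists (Num.min h1 h2); first by rewrite lt_min h10.
move=> y y0; rewrite lt_min => /andP[yh1 yh2]; rewrite ler_norml.
have [xy|yx] := leP x y.
  have := H2 _ xy yh2; have := level_nonincreasing x0 xy.
  by move=> ? ?; apply/andP; split; lra.
have := level_nonincreasing y0 (ltW yx); have := H1 y; rewrite y0 (ltW yx).
by move=> /(_ isT yh1) ? ?; apply/andP; split; lra.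
Qed.

Lemma ground_level_continuous_within (D : set R) :
  D `<=` [set mu | 0 <= mu] -> {within D, continuous (ground_level p q)}.
Proof.
move=> D0; apply: (@subspace_eq_continuous _ _ _ (EFin \o level)).
  by move=> x; rewrite inE => /D0 /= x0; exact/esym/levelE.
apply/subspace_continuousP => x Dx.
apply: cvg_EFin; first exact: nearW.
apply/cvgrPdist_le => e e0.
have [h h0 H] := level_continuous (D0 _ Dx) e0.
rewrite near_withinE; near=> y => Dy; apply: H; first exact: D0.
by near: y; exists h => //= y; rewrite distrC.
Unshelve. all: by end_near. Qed.

End Subcritical.

(** At the critical exponent the hypothesis forces q = 4 and p < 6, where finite means mass at most
    2 and level 0; above it the level is finite at mass 0 only. In both cases the function is
    constant on the interval. *)
Lemma ground_level_continuous p q : 2 < p -> 0 < q ->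
  (q != p / 2 + 1) || (p < 6) -> forall I : interval R,
  [set` I] `<=` [set mu | 0 <= mu] ->
  (forall mu : R, mu \in I -> ground_level p q mu \is a fin_num) ->
  {within [set` I], continuous (ground_level p q)}.
Proof.
move=> p2 q0 qp I I0 fI.
have cst_case (c : \bar R) : {in [set` I], cst c =1 ground_level p q} ->
    {within [set` I], continuous (ground_level p q)}.
  move=> /subspace_eq_continuous; apply; apply: continuous_subspaceT => x.
  exact: cvg_cst.
have [qmax|] := ltP q (Num.max 4 (p / 2 + 1)).
  exact: ground_level_continuous_within.
rewrite le_eqVlt => /predU1P[qmax|qmax].
  apply: (cst_case 0%E) => x; rewrite inE /= => xI.
  have [q4 p6] : q = 4 /\ p < 6.
    move: qmax qp; have [H|H] := leP 4 (p / 2 + 1) => <-.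
      by rewrite eqxx /= => ?; split => //; lra.
    by move=> _; split => //; lra.
  rewrite q4 ground_level_critical0//; apply/andP; split; first exact: I0.
  rewrite leNgt; apply/negP => x2.
  have := fI x xI; rewrite q4 ground_level_critical_Ny//.
  by rewrite p2 p6.
apply: (cst_case (ground_level p q 0)) => x; rewrite inE /= => xI.
have x0 : 0 <= x by exact: I0.
have [->//|xn0] := eqVneq x 0.
have := fI x xI; rewrite ground_level_supercritical//.
by rewrite lt_neqAle eq_sym xn0.
Qed.

End Continuity.

Theorem theorem1p4 (R : realType) (p q : R) (hp : 2 < p) (hq : 2 < q) :
  [/\ (forall mu : R, 0 <= mu -> (ground_level p q mu <= 0)%E)
      /\ (forall mu nu : R, 0 <= mu -> mu <= nu ->
            (ground_level p q nu <= ground_level p q mu)%E),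
      q < Num.max 4 (p / 2 + 1) ->
        forall mu : R, 0 < mu -> (-oo < ground_level p q mu)%E,
      2 < p < 6 -> q = 4 ->
        (forall mu : R, 0 < mu <= 2 -> ground_level p 4 mu = 0%E)
        /\ (forall mu : R, 2 < mu -> ground_level p 4 mu = -oo%E),
      Num.max 4 (p / 2 + 1) < q ->
        forall mu : R, 0 < mu -> ground_level p q mu = -oo%E
    & (q != p / 2 + 1) || (p < 6) ->
        forall I : interval R,
          [set` I] `<=` [set mu | 0 <= mu] ->
          (forall mu : R, mu \in I -> ground_level p q mu \is a fin_num) ->
          {within [set` I], continuous (ground_level p q)}].
Proof.
have q0 : 0 < q by lra.
split.
- split=> [mu mu0|mu nu _]; first exact: ground_level_le0.
  exact: ground_level_nonincreasing.
- by move=> qmax mu _; exact: ground_level_gtNy.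
- move=> p26 _; split=> mu; last exact: ground_level_critical_Ny.
  by move=> /andP[mu0 mu2]; apply: ground_level_critical0; rewrite ?(ltW mu0).
- by move=> qmax mu; exact: ground_level_supercritical.
- exact: ground_level_continuous.
Qed.
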